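(* (1) (Explicit Bruhat decomposition of $\mathrm F_{4(-20)}$.) $\mathrm F_{4(-20)}=N^-MAN^+\ \amalg\ \sigma MAN^+$, where $$N^-MAN^+=\{g\in\mathrm F_{4(-20)}:(gP^-|\sigma P^-)\neq0\}=\{g\in\mathrm F_{4(-20)}:(gP^-|\sigma P^-)>0\},$$ $$\sigma MAN^+=N^-\sigma MAN^+=\{g\in\mathrm F_{4(-20)}:(gP^-|\sigma P^-)=0\}=\{g\in\mathrm F_{4(-20)}:g[P^-]=[\sigma P^-]\}.$$ Furthermore $N^-MAN^+$ is an open dense submanifold of $\mathrm F_{4(-20)}$. (2) (Explicit Gauss decomposition of $\mathrm F_{4(-20)}$.) For every $g\in N^-MAN^+$ there exist unique $n_G^-(g)\in N^-$, $m_G(g)\in M$, $a_G(g)\in A$, $n_G^+(g)\in N^+$ such that $g=n_G^-(g)m_G(g)a_G(g)n_G^+(g)$, and they are given by (i) $a_G(g)=\exp\bigl(\tfrac12\log\bigl(\tfrac14(gP^-|\sigma P^-)\bigr)\tilde A_3^1(1)\bigr)$, (ii) $n_G^-(g)=\exp\Bigl(\mathcal G_{-1}\bigl(-\tfrac12\bigl(\sum_{i=0}^7(Q^-(e_i)|gP^-)e_i\bigr)/(gP^-|\sigma P^-)\bigr)+\mathcal G_{-2}\bigl(-\tfrac12\bigl(\sum_{i=1}^7(F_3^1(e_i)|gP^-)e_i\bigr)/(gP^-|\sigma P^-)\bigr)\Bigr)$, (iii) $n_G^+(g)=n_I(n_G^-(g)^{-1}g)$, (iv) $m_G(g)=n_G^-(g)^{-1}\,g\,n_G^+(g)^{-1}a_G(g)^{-1}$,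 where $n_I:\mathrm F_{4(-20)}\to N^+$ is the $N^+$-factor of the Iwasawa decomposition.
   Context: Octonions: $\mathbf O$ is the real division algebra of octonions with standard basis $1=e_0,e_1,\dots,e_7$, conjugation $x\mapsto\overline x$, inner product $(x|y)=\mathrm{Re}(x\overline y)$, and $\mathrm{Im}\,\mathbf O=\mathrm{span}_{\mathbb R}(e_1,\dots,e_7)$. Jordan algebra: for $\xi_i\in\mathbb R$, $x_i\in\mathbf O$ let $$h^1(\xi_1,\xi_2,\xi_3;x_1,x_2,x_3)=\begin{pmatrix}\xi_1&\sqrt{-1}x_3&\sqrt{-1}\,\overline{x_2}\\ \sqrt{-1}\,\overline{x_3}&\xi_2&x_1\\ \sqrt{-1}x_2&\overline{x_1}&\xi_3\end{pmatrix}$$ (entries in $\mathbf O\otimes_{\mathbb R}\mathbb C$). $\mathcal J^1$ is the real vector space of all these matrices, with Jordan product $X\circ Y=\frac12(XY+YX)$, trace $\mathrm{tr}(X)=\xi_1+\xi_2+\xi_3$, bilinear form $(X|Y)=\mathrm{tr}(X\circ Y)=\sum\xi_i\eta_i+2(x_1|y_1)-2(x_2|y_2)-2(x_3|y_3)$. For $X=h^1(\xi_1,\xi_2,\xi_3;x_1,x_2,x_3)$, $X^{\times2}=h^1(\xi_2\xi_3-(x_1|x_1),\ \xi_3\xi_1+(x_2|x_2),\ \xi_1\xi_2+(x_3|x_3);\ -\overline{x_2x_3}-\xi_1x_1,\ \overline{x_3x_1}-\xi_2x_2,\ \overline{x_1x_2}-\xi_3x_3)$. $E_i=h^1(\delta_{i1},\delta_{i2},\delta_{i3};0,0,0)$,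 $F_i^1(x)=h^1(0,0,0;\delta_{i1}x,\delta_{i2}x,\delta_{i3}x)$, $P^-=h^1(-1,1,0;0,0,1)$, $Q^+(x)=h^1(0,0,0;x,\overline x,0)$, $Q^-(x)=h^1(0,0,0;x,-\overline x,0)$. Group: $\mathrm F_{4(-20)}=\{g\in \mathrm{GL}_{\mathbb R}(\mathcal J^1): g(X\circ Y)=gX\circ gY\}$, with Lie algebra $\mathfrak f_{4(-20)}$; $\exp$ is the exponential of linear maps. $\sigma\in\mathrm F_{4(-20)}$ is $\sigma h^1(\xi_1,\xi_2,\xi_3;x_1,x_2,x_3)=h^1(\xi_1,\xi_2,\xi_3;x_1,-x_2,-x_3)$. Operators in $\mathfrak f_{4(-20)}$: for $a\in\mathbf O$, on $X=h^1(\xi_1,\xi_2,\xi_3;x_1,x_2,x_3)$, $\tilde A_1^1(a)X=h^1(0,2(a|x_1),-2(a|x_1);-(\xi_2-\xi_3)a,-\overline{x_3a},\overline{ax_2})$, $\tilde A_2^1(a)X=h^1(2(a|x_2),0,-2(a|x_2);-\overline{ax_3},-(\xi_3-\xi_1)a,-\overline{x_1a})$, $\tilde A_3^1(a)X=h^1(-2(a|x_3),2(a|x_3),0;\overline{x_2a},\overline{ax_1},-(\xi_1-\xi_2)a)$; for $p\in\mathrm{Im}\,\mathbf O$, $\delta(p)X=h^1(0,0,0;px_1,x_2p,-(px_3+x_3p))$. Put $\mathcal G_{\pm1}(x)=\tilde A_1^1(x)+\tilde A_2^1(\mp\overline x)$ and $\mathcal G_{\pm2}(p)=\tilde A_3^1(\mp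 p)-\delta(p)$. Subgroups: $K=\{g\in\mathrm F_{4(-20)}:\sigma g\sigma=g\}$; $A=\{\exp(t\tilde A_3^1(1)):t\in\mathbb R\}$; $M=\{k\in K:k\tilde A_3^1(1)k^{-1}=\tilde A_3^1(1)\}$; $N^\pm=\{\exp(\mathcal G_{\pm1}(x)+\mathcal G_{\pm2}(p)):x\in\mathbf O,\ p\in\mathrm{Im}\,\mathbf O\}$. Iwasawa factor: every $g\in\mathrm F_{4(-20)}$ is uniquely $g=k\,a\,n$ with $k\in K$, $a\in A$, $n\in N^+$, and $n_I(g):=n$; explicitly $n_I(g)=\exp\bigl(\mathcal G_1(\tfrac12(\sum_{i=0}^7(gQ^+(e_i)|E_1)e_i)/(gP^-|E_1))+\mathcal G_2(-\tfrac12(\sum_{i=1}^7(gF_3^1(e_i)|E_1)e_i)/(gP^-|E_1))\bigr)$. $\mathcal N_1^-=\{X\in\mathcal J^1: X^{\times2}=0,\ \mathrm{tr}(X)=0,\ (E_1|X)<0\}$, an $\mathrm F_{4(-20)}$-orbit. For $X,Y\in\mathcal N_1^-$, $X\sim Y$ iff $Y=rX$ for some $r>0$; $[X]$ is the class of $X$, and $g[X]=[gX]$. *)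

(* Defs.v *)
From HB Require Import structures.
From mathcomp Require Import all_boot all_order all_algebra.
From mathcomp Require Import all_classical all_reals all_analysis.
From mathcomp Require Import ring.

Set Implicit Arguments.
Unset Strict Implicit.
Unset Printing Implicit Defensive.

Import Order.TTheory GRing.Theory Num.Theory.
Import numFieldNormedType.Exports.

Local Open Scope classical_set_scope.
Local Open Scope ring_scope.

Section Octonions.
Context {R : realType}.

Notation H := 'cV[R]_4.
Notation O := 'cV[R]_8.

Definition qcoef (a : H) (k : nat) : R := a (inord k) ord0.

Definition quat (a0 a1 a2 a3 : R) : H :=
  \col_(k < 4) nth 0 [:: a0; a1; a2; a3] k.

Definition qmul (a b : H) : H :=
  let: (a0, a1, a2, a3) := (qcoef a 0, qcoef a 1, qcoef a 2, qcoef a 3) in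
  let: (b0, b1, b2, b3) := (qcoef b 0, qcoef b 1, qcoef b 2, qcoef b 3) in
  quat (a0 * b0 - a1 * b1 - a2 * b2 - a3 * b3)
       (a0 * b1 + a1 * b0 + a2 * b3 - a3 * b2)
       (a0 * b2 - a1 * b3 + a2 * b0 + a3 * b1)
       (a0 * b3 + a1 * b2 - a2 * b1 + a3 * b0).

Definition qconj (a : H) : H :=
  quat (qcoef a 0) (- qcoef a 1) (- qcoef a 2) (- qcoef a 3).

(* O = H + H e_4 (Cayley-Dickson):                                            *)
(*   (a + b e_4) (c + d e_4) = (a c - conj d b) + (d a + b conj c) e_4,       *)
(* so that e_5 = e_1 e_4, e_6 = e_2 e_4 and e_7 = e_3 e_4.                    *)
Definition opair (a b : H) : O := col_mx a b.
Definition ofst (x : O) : H := @usubmx R 4 4 1 x.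
Definition osnd (x : O) : H := @dsubmx R 4 4 1 x.

Definition omul (x y : O) : O :=
  let: (a, b) := (ofst x, osnd x) in
  let: (c, d) := (ofst y, osnd y) in
  opair (qmul a c - qmul (qconj d) b) (qmul d a + qmul b (qconj c)).

Definition oconj (x : O) : O := opair (qconj (ofst x)) (- osnd x).

Definition obase (i : 'I_8) : O := delta_mx i ord0.
Definition oone : O := obase ord0.
Definition oRe (x : O) : R := x ord0 ord0.
Definition odot (x y : O) : R := oRe (omul x (oconj y)).

Definition ImO : set O :=
  [set p | exists c : 'I_7 -> R, p = \sum_(i < 7) c i *: obase (lift ord0 i)].

(* O (x) C : the pair (x, y) stands for x + sqrt(-1) y. *)
Definition ocmul (u v : O * O) : O * O :=
  (omul u.1 v.1 - omul u.2 v.2, omul u.1 v.2 + omul u.2 v.1).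
Definition oc_re (x : O) : O * O := (x, 0).
Definition oc_im (x : O) : O * O := (0, x).

End Octonions.

(* J^1 is identified with R^27 = R^3 + O^3 through the coordinates            *)
(* (xi_1, xi_2, xi_3; x_1, x_2, x_3) of h^1; linear endomorphisms of J^1 are  *)
(* 27 x 27 matrices acting on columns.                                        *)
Section JordanAlgebra.
Context {R : realType}.

Notation O := 'cV[R]_8.
Notation J := 'cV[R]_27.

Definition h1 (xi1 xi2 xi3 : R) (x1 x2 x3 : O) : J :=
  col_mx (\col_(i < 3) nth 0 [:: xi1; xi2; xi3] i) (col_mx x1 (col_mx x2 x3)).

Definition jxi (X : J) (k : nat) : R :=
  @usubmx R 3 24 1 X (inord k) ord0.
Definition jxi1 X := jxi X 0.
Definition jxi2 X := jxi X 1.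
Definition jxi3 X := jxi X 2.
Definition jx1 (X : J) : O := @usubmx R 8 16 1 (@dsubmx R 3 24 1 X).
Definition jx2 (X : J) : O :=
  @usubmx R 8 8 1 (@dsubmx R 8 16 1 (@dsubmx R 3 24 1 X)).
Definition jx3 (X : J) : O :=
  @dsubmx R 8 8 1 (@dsubmx R 8 16 1 (@dsubmx R 3 24 1 X)).

Definition mat3 (M : seq (seq (O * O))) : 'M[O * O]_3 :=
  \matrix_(i < 3, j < 3) nth 0 (nth [::] M i) j.

Definition jmat (X : J) : 'M[O * O]_3 :=
  let x1 := jx1 X in let x2 := jx2 X in let x3 := jx3 X in
  mat3 [:: [:: oc_re (jxi1 X *: oone); oc_im x3; oc_im (oconj x2)];
           [:: oc_im (oconj x3); oc_re (jxi2 X *: oone); oc_re x1];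
           [:: oc_im x2; oc_re (oconj x1); oc_re (jxi3 X *: oone)]].

Definition ocmulmx (P Q : 'M[O * O]_3) : 'M[O * O]_3 :=
  \matrix_(i, j) \sum_(k < 3) ocmul (P i k) (Q k j).

Definition jordan_mx (P Q : 'M[O * O]_3) : 'M[O * O]_3 :=
  \matrix_(i, j) (2^-1 *: (ocmulmx P Q i j + ocmulmx Q P i j)).

(* The coordinates of a matrix of J^1, inverse to jmat; see jmatK and jmulE. *)
Definition jcoord (M : 'M[O * O]_3) : J :=
  let: i1 := inord 0 in let: i2 := inord 1 in let: i3 := inord 2 in
  h1 (oRe (M i1 i1).1) (oRe (M i2 i2).1) (oRe (M i3 i3).1)
     (M i2 i3).1 (M i3 i1).2 (M i1 i2).2.

Definition jmul (X Y : J) : J := jcoord (jordan_mx (jmat X) (jmat Y)).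

Definition jtr (X : J) : R := jxi1 X + jxi2 X + jxi3 X.
Definition jform (X Y : J) : R := jtr (jmul X Y).

Definition jcross2 (X : J) : J :=
  let: (a1, a2, a3) := (jxi1 X, jxi2 X, jxi3 X) in
  let: (x1, x2, x3) := (jx1 X, jx2 X, jx3 X) in
  h1 (a2 * a3 - odot x1 x1) (a3 * a1 + odot x2 x2) (a1 * a2 + odot x3 x3)
     (- oconj (omul x2 x3) - a1 *: x1)
     (oconj (omul x3 x1) - a2 *: x2)
     (oconj (omul x1 x2) - a3 *: x3).

Definition E1 : J := h1 1 0 0 0 0 0.
Definition F31 (x : O) : J := h1 0 0 0 0 0 x.
Definition Pminus : J := h1 (-1) 1 0 0 0 oone.
Definition Qminus (x : O) : J := h1 0 0 0 x (- oconj x) 0.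

Definition N1minus : set J :=
  [set X | [/\ jcross2 X = 0, jtr X = 0 & jform E1 X < 0]].

(* The class [X] of X in N1minus under positive rescaling. *)
Definition ray (X : J) : set J :=
  [set Y | N1minus Y /\ exists2 r : R, 0 < r & Y = r *: X].

End JordanAlgebra.

Section Group.
Variable R : realType.

Notation O := 'cV[R]_8.
Notation J := 'cV[R]_27.
Notation L := 'M[R]_27.

Definition lmx (f : J -> J) : L := \matrix_(i, j) f (delta_mx j ord0) i ord0.

Definition mxexp (T : L) : L :=
  limn (series (fun k : nat => (k`!%:R)^-1 *: T ^+ k)).

Definition F4 : set L :=
  [set g | g \in unitmx /\
    forall X Y : J, g *m jmul X Y = jmul (g *m X) (g *m Y)].

Definition sigma : L := lmx (fun X : J =>
  h1 (jxi1 X) (jxi2 X) (jxi3 X) (jx1 X) (- jx2 X) (- jx3 X)).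

Definition A1 (a : O) : L := lmx (fun X : J =>
  h1 0 (2 * odot a (jx1 X)) (- (2 * odot a (jx1 X)))
     (- ((jxi2 X - jxi3 X) *: a)) (- oconj (omul (jx3 X) a))
     (oconj (omul a (jx2 X)))).

Definition A2 (a : O) : L := lmx (fun X : J =>
  h1 (2 * odot a (jx2 X)) 0 (- (2 * odot a (jx2 X)))
     (- oconj (omul a (jx3 X))) (- ((jxi3 X - jxi1 X) *: a))
     (- oconj (omul (jx1 X) a))).

Definition A3 (a : O) : L := lmx (fun X : J =>
  h1 (- (2 * odot a (jx3 X))) (2 * odot a (jx3 X)) 0
     (oconj (omul (jx2 X) a)) (oconj (omul a (jx1 X)))
     (- ((jxi1 X - jxi2 X) *: a))).

Definition odelta (p : O) : L := lmx (fun X : J =>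
  h1 0 0 0 (omul p (jx1 X)) (omul (jx2 X) p)
     (- (omul p (jx3 X) + omul (jx3 X) p))).

Definition Gp1 (x : O) : L := A1 x + A2 (- oconj x).
Definition Gm1 (x : O) : L := A1 x + A2 (oconj x).
Definition Gp2 (p : O) : L := A3 (- p) - odelta p.
Definition Gm2 (p : O) : L := A3 p - odelta p.

Definition grK : set L := [set g | F4 g /\ sigma * g * sigma = g].
Definition grA : set L := [set mxexp (t *: A3 oone) | t in [set: R]].
Definition grM : set L :=
  [set k | grK k /\ k * A3 oone * k^-1 = A3 oone].
Definition grNp : set L :=
  [set mxexp (Gp1 x + Gp2 p) | x in [set: O] & p in ImO].
Definition grNm : set L :=
  [set mxexp (Gm1 x + Gm2 p) | x in [set: O] & p in ImO].

(* The N^+-factor of the Iwasawa decomposition F4 = K A N^+. *)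
Definition iwasawa_n (g : L) : L :=
  get [set n | grNp n /\
    exists k a : L, [/\ grK k, grA a & g = k * a * n]].

Definition mulset (S T : set L) : set L := [set s * t | s in S & t in T].

Definition NMAN : set L :=
  mulset (mulset (mulset grNm grM) grA) grNp.
Definition sMAN : set L :=
  mulset (mulset (mulset [set sigma] grM) grA) grNp.
Definition NsMAN : set L :=
  mulset (mulset (mulset (mulset grNm [set sigma]) grM) grA) grNp.

End Group.

Arguments sigma {R}.
Arguments F4 R : clear implicits.
Arguments grK R : clear implicits.
Arguments grA R : clear implicits.
Arguments grM R : clear implicits.
Arguments grNp R : clear implicits.
Arguments grNm R : clear implicits.
Arguments NMAN R : clear implicits.
Arguments sMAN R : clear implicits.
Arguments NsMAN R : clear implicits.

Section Facts.
Context {R : realType}.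

Notation O := 'cV[R]_8.
Notation J := 'cV[R]_27.

Lemma usub_h1 (a b c : R) (x y z : O) :
  @usubmx R 3 24 1 (h1 a b c x y z) = \col_(i < 3) nth 0 [:: a; b; c] i.
Proof. exact: (@col_mxKu R 3 24 1). Qed.

Lemma dsub_h1 (a b c : R) (x y z : O) :
  @dsubmx R 3 24 1 (h1 a b c x y z) = col_mx x (col_mx y z).
Proof. exact: (@col_mxKd R 3 24 1). Qed.

Lemma jxi1_h1 (a b c : R) (x y z : O) : jxi1 (h1 a b c x y z) = a.
Proof. by rewrite /jxi1 /jxi usub_h1 mxE inordK. Qed.
Lemma jxi2_h1 (a b c : R) (x y z : O) : jxi2 (h1 a b c x y z) = b.
Proof. by rewrite /jxi2 /jxi usub_h1 mxE inordK. Qed.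
Lemma jxi3_h1 (a b c : R) (x y z : O) : jxi3 (h1 a b c x y z) = c.
Proof. by rewrite /jxi3 /jxi usub_h1 mxE inordK. Qed.
Lemma jx1_h1 (a b c : R) (x y z : O) : jx1 (h1 a b c x y z) = x.
Proof. by rewrite /jx1 dsub_h1; exact: (@col_mxKu R 8 16 1). Qed.
Lemma jx2_h1 (a b c : R) (x y z : O) : jx2 (h1 a b c x y z) = y.
Proof.
rewrite /jx2 dsub_h1 [@dsubmx _ 8 16 _ _](@col_mxKd R 8 16 1).
exact: (@col_mxKu R 8 8 1).
Qed.
Lemma jx3_h1 (a b c : R) (x y z : O) : jx3 (h1 a b c x y z) = z.
Proof.
rewrite /jx3 dsub_h1 [@dsubmx _ 8 16 _ _](@col_mxKd R 8 16 1).
exact: (@col_mxKd R 8 8 1).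
Qed.

Definition h1E := (jxi1_h1, jxi2_h1, jxi3_h1, jx1_h1, jx2_h1, jx3_h1).

Lemma h1_eta (X : J) :
  X = h1 (jxi1 X) (jxi2 X) (jxi3 X) (jx1 X) (jx2 X) (jx3 X).
Proof.
have -> : h1 (jxi1 X) (jxi2 X) (jxi3 X) (jx1 X) (jx2 X) (jx3 X) =
    @col_mx R 3 24 1 (@usubmx R 3 24 1 X) (@dsubmx R 3 24 1 X).
  rewrite /h1; congr (@col_mx R 3 24 1 _ _); last first.
    rewrite /jx1 /jx2 /jx3 [@col_mx R 8 8 1 _ _](@vsubmxK R 8 8 1).
    exact: (@vsubmxK R 8 16 1).
  apply/matrixP => i j; rewrite !ord1 mxE /jxi1 /jxi2 /jxi3 /jxi.
  by case: i => [[|[|[|i]]] hi] //=;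
    congr (@usubmx R 3 24 1 X _ _); apply/val_inj; rewrite /= inordK.
by symmetry; exact: (@vsubmxK R 3 24 1).
Qed.

Lemma qcoef_quat (a b c d : R) :
  (qcoef (quat a b c d) 0 = a) * (qcoef (quat a b c d) 1 = b) *
  (qcoef (quat a b c d) 2 = c) * (qcoef (quat a b c d) 3 = d).
Proof. by rewrite /qcoef !mxE !inordK. Qed.

Lemma qcoefD (a b : 'cV[R]_4) k : qcoef (a + b) k = qcoef a k + qcoef b k.
Proof. by rewrite /qcoef mxE. Qed.
Lemma qcoefN (a : 'cV[R]_4) k : qcoef (- a) k = - qcoef a k.
Proof. by rewrite /qcoef mxE. Qed.
Lemma qcoefZ r (a : 'cV[R]_4) k : qcoef (r *: a) k = r * qcoef a k.
Proof. by rewrite /qcoef mxE. Qed.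
Lemma qcoef0 k : qcoef (0 : 'cV[R]_4) k = 0.
Proof. by rewrite /qcoef mxE. Qed.

Lemma ofst_pair (a b : 'cV[R]_4) : ofst (opair a b) = a.
Proof. exact: (@col_mxKu R 4 4 1). Qed.
Lemma osnd_pair (a b : 'cV[R]_4) : osnd (opair a b) = b.
Proof. exact: (@col_mxKd R 4 4 1). Qed.
Lemma ofstD (x y : O) : ofst (x + y) = ofst x + ofst y.
Proof. by apply/matrixP => i j; rewrite !mxE. Qed.
Lemma osndD (x y : O) : osnd (x + y) = osnd x + osnd y.
Proof. by apply/matrixP => i j; rewrite !mxE. Qed.
Lemma ofstN (x : O) : ofst (- x) = - ofst x.
Proof. by apply/matrixP => i j; rewrite !mxE. Qed.
Lemma osndN (x : O) : osnd (- x) = - osnd x.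
Proof. by apply/matrixP => i j; rewrite !mxE. Qed.
Lemma ofstZ r (x : O) : ofst (r *: x) = r *: ofst x.
Proof. by apply/matrixP => i j; rewrite !mxE. Qed.
Lemma osndZ r (x : O) : osnd (r *: x) = r *: osnd x.
Proof. by apply/matrixP => i j; rewrite !mxE. Qed.
Lemma ofst0 : ofst (0 : O) = 0.
Proof. by apply/matrixP => i j; rewrite !mxE. Qed.
Lemma osnd0 : osnd (0 : O) = 0.
Proof. by apply/matrixP => i j; rewrite !mxE. Qed.
Lemma ofst1 : ofst (oone : O) = quat 1 0 0 0.
Proof.
by apply/matrixP => i j; rewrite !mxE !ord1 -!val_eqE /=;
  case: i => [[|[|[|[|i]]]] hi].
Qed.
Lemma osnd1 : osnd (oone : O) = 0.
Proof. by apply/matrixP => i j; rewrite !mxE !ord1 -!val_eqE. Qed.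

Lemma oReE (x : O) : oRe x = qcoef (ofst x) 0.
Proof.
rewrite /oRe /qcoef mxE; congr (x _ _).
by apply/val_inj; rewrite /= inordK.
Qed.

Definition octE := (ofst_pair, osnd_pair, ofstD, osndD, ofstN, osndN, ofstZ,
  osndZ, ofst0, osnd0, ofst1, osnd1, oReE, qcoef_quat, qcoefD, qcoefN, qcoefZ,
  qcoef0).

Lemma quatP (a b : 'cV[R]_4) : qcoef a 0 = qcoef b 0 ->
  qcoef a 1 = qcoef b 1 -> qcoef a 2 = qcoef b 2 -> qcoef a 3 = qcoef b 3 ->
  a = b.
Proof.
rewrite /qcoef => e0 e1 e2 e3; apply/matrixP => i j; rewrite ord1.
rewrite -[i]inord_val.
by case: i => [[|[|[|[|i]]]] hi].
Qed.

Lemma octP (x y : O) : ofst x = ofst y -> osnd x = osnd y -> x = y.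
Proof.
rewrite /ofst /osnd => e1 e2.
rewrite -[x](@vsubmxK R 4 4 1) -[y](@vsubmxK R 4 4 1).
by congr (@col_mx R 4 4 1 _ _).
Qed.

Lemma jmatK (X : J) : jcoord (jmat X) = X.
Proof.
rewrite [RHS]h1_eta /jcoord /jmat /mat3 !mxE !inordK //= !octE.
by rewrite !mulr1.
Qed.

Lemma omul0x (x : O) : omul 0 x = 0.
Proof.
by apply: octP; rewrite /omul /qmul /qconj !octE; apply: quatP; rewrite !octE; ring.
Qed.
Lemma omulx0 (x : O) : omul x 0 = 0.
Proof.
by apply: octP; rewrite /omul /qmul /qconj !octE; apply: quatP; rewrite !octE; ring.
Qed.
Lemma omulZ1x r (x : O) : omul (r *: oone) x = r *: x.
Proof.
by apply: octP; rewrite /omul /qmul /qconj !octE; apply: quatP; rewrite !octE; ring.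
Qed.
Lemma omulxZ1 r (x : O) : omul x (r *: oone) = r *: x.
Proof.
by apply: octP; rewrite /omul /qmul /qconj !octE; apply: quatP; rewrite !octE; ring.
Qed.
Lemma oconjM (x y : O) : oconj (omul x y) = omul (oconj y) (oconj x).
Proof.
by apply: octP; rewrite /oconj /omul /qmul /qconj !octE; apply: quatP; rewrite !octE; ring.
Qed.
Lemma oconjK : involutive (@oconj R).
Proof.
by move=> x; apply: octP; rewrite /oconj /qconj !octE; apply: quatP; rewrite !octE; ring.
Qed.
Lemma oconjD (x y : O) : oconj (x + y) = oconj x + oconj y.
Proof.
by apply: octP; rewrite /oconj /qconj !octE; apply: quatP; rewrite !octE; ring.
Qed.
Lemma oconjN (x : O) : oconj (- x) = - oconj x.
Proof.
by apply: octP; rewrite /oconj /qconj !octE; apply: quatP; rewrite !octE; ring.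
Qed.
Lemma oconjZ r (x : O) : oconj (r *: x) = r *: oconj x.
Proof.
by apply: octP; rewrite /oconj /qconj !octE; apply: quatP; rewrite !octE; ring.
Qed.
Lemma oconj1 : oconj oone = oone :> O.
Proof.
by apply: octP; rewrite /oconj /qconj !octE; apply: quatP; rewrite !octE; ring.
Qed.
Lemma oconj_real (x : O) : oconj x = x -> oRe x *: oone = x.
Proof.
move=> xE; have -> : x = 2^-1 *: (x + oconj x).
  by rewrite xE -mulr2n -(scaler_nat 2 x) scalerA mulVf ?scale1r // pnatr_eq0.
by apply: octP; rewrite /oconj /qconj !octE; apply: quatP; rewrite !octE; field.
Qed.

Lemma mat3E (M : seq (seq (O * O))) i j : (i < 3)%N -> (j < 3)%N ->
  mat3 M (inord i) (inord j) = nth 0 (nth [::] M i) j.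
Proof. by move=> hi hj; rewrite mxE !inordK. Qed.

Lemma ord3P (P : 'I_3 -> Prop) :
  P (inord 0) -> P (inord 1) -> P (inord 2) -> forall i, P i.
Proof.
by move=> P0 P1 P2 i; rewrite -[i]inord_val; case: i => [[|[|[|i]]] hi].
Qed.

Lemma sum_ord3 (V : nmodType) (F : 'I_3 -> V) :
  \sum_(k < 3) F k = F (inord 0) + F (inord 1) + F (inord 2).
Proof.
transitivity (\sum_(0 <= k < 3) F (inord k)).
  by rewrite big_mkord; apply: eq_bigr => k _; rewrite inord_val.
by rewrite !big_nat_recr //= big_geq //= add0r.
Qed.

Lemma ocmulmxE (P Q : 'M[O * O]_3) i j :
  ocmulmx P Q i j = ocmul (P i (inord 0)) (Q (inord 0) j) +
    ocmul (P i (inord 1)) (Q (inord 1) j) +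
    ocmul (P i (inord 2)) (Q (inord 2) j).
Proof.
by rewrite mxE sum_ord3.
Qed.

Lemma jordan_mxE (P Q : 'M[O * O]_3) i j :
  jordan_mx P Q i j = 2^-1 *: (ocmulmx P Q i j + ocmulmx Q P i j).
Proof. by rewrite mxE. Qed.

#[local] Opaque omul oconj.

Lemma jmulE (X Y : J) : jmat (jmul X Y) = jordan_mx (jmat X) (jmat Y).
Proof.
rewrite {1}/jmat /jmul /jcoord !h1E /jmat.
move: (jxi1 X) (jxi2 X) (jxi3 X) (jx1 X) (jx2 X) (jx3 X) => a1 a2 a3 x1 x2 x3.
move: (jxi1 Y) (jxi2 Y) (jxi3 Y) (jx1 Y) (jx2 Y) (jx3 Y) => b1 b2 b3 y1 y2 y3.
rewrite !jordan_mxE !ocmulmxE !mat3E // /=.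
apply/matrixP; apply: ord3P; apply: ord3P.
all: rewrite jordan_mxE !ocmulmxE !mat3E //=.
all: rewrite /ocmul /oc_re /oc_im /=; congr pair => /=.
all: rewrite ?omul0x ?omulx0 ?omulZ1x ?omulxZ1.
all: rewrite ?subr0 ?sub0r ?oppr0 ?addr0 ?add0r ?scaler0.
all: try reflexivity.
all: try apply: oconj_real.
all: rewrite !(oconjZ, oconjD, oconjN, oconjM, oconjK, oconj1) addrC.
all: try reflexivity.
all: have sC r s : r *: (s *: oone) = s *: (r *: oone) :> O
  by rewrite !scalerA mulrC.
- by rewrite [b1 *: _]sC.
- by rewrite [b2 *: _]sC.
- by rewrite [b3 *: _]sC.
Qed.

Lemma lmxE (f : J -> J) (X : J) : linear f -> lmx f *m X = f X.
Proof.
move=> fl; pose lf := GRing.isLinear.Build R J J *:%R f fl.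
pose F : {linear J -> J} := HB.pack f lf.
apply/matrixP => i j; rewrite ord1 [X in RHS]matrix_sum_delta.
rewrite mxE -[f]/(F : J -> J) linear_sum summxE; apply: eq_bigr => k _.
by rewrite big_ord1 linearZ !mxE mulrC.
Qed.

End Facts.

(* Main.v *)
(* Write P = P^-, c(X) = (X | sigma P). Under ad A_3^1(1) the space J^1 has
   weights -2, ..., 2, the extreme weight spaces being spanned by P and sigma P,
   and G_{-1}(x) + G_{-2}(p) lowers weights; so it is nilpotent and its
   exponential n fixes sigma P, while the weight -1 and 0 coordinates of n X
   recover (x, p) as soon as c(X) <> 0. A vector X with X o X = 0 and tr X = 0
   is (c(X)/4) n P for some n in N^- if c(X) <> 0, and a multiple of sigma P
   otherwise. Apply this to X = g P: after removing n (or sigma), what is left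
   of g preserves the line of P, on which it acts by a positive scalar since the
   form (P o Y | Y) is positive semidefinite on the orthogonal of P. Dividing by
   an element of A leaves the stabilizer of P, which is M N^+ because M is the
   joint stabilizer of P and sigma P; the latter holds since A_3^1(1) is the
   commutator of the multiplications by P and sigma P, and K fixes E_1. *)
Require Import Defs.
From mathcomp Require Import all_boot all_order all_algebra.
From mathcomp Require Import all_classical all_reals all_analysis.
From mathcomp Require Import ring lra.

Set Implicit Arguments.
Unset Strict Implicit.
Unset Printing Implicit Defensive.

Import Order.TTheory GRing.Theory Num.Theory.
Import numFieldNormedType.Exports.

Local Open Scope classical_set_scope.
Local Open Scope ring_scope.

(** * Octonions as vectors of eight real coordinates *)

Section OctonionCoordinates.
Context {R : realType}.
Notation O := 'cV[R]_8.

(** [F4] asks only for compatibility with the product, so invariance of the trace has to be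
    extracted from it: the Jordan trace is read off the matrix traces of multiplication operators,
    which automorphisms conjugate. The exponential is the limit of a series, but both kinds that
    occur have a closed form. [Gm x p] has fifth power zero, which leaves a finite sum; [A3 oone] is
    killed by t(t^2 - 1)(t^2 - 4), which gives five spectral projections. In either form the Leibniz
    rule shows directly that the exponential of a derivation is an automorphism. N^+ is treated as
    the conjugate of N^- by sigma, so unipotent computations are made for N^- alone. As the
    octonions are not associative, their identities are checked on eight real coordinates.
    Uniqueness comes from acting on two vectors: P, which M and N^+ fix and A scales by e^(2t), and
    E_1, which K fixes. *)

Definition oct (a0 a1 a2 a3 a4 a5 a6 a7 : R) : O :=
  opair (quat a0 a1 a2 a3) (quat a4 a5 a6 a7).

Lemma oct_ind (P : O -> Prop) :
  (forall a0 a1 a2 a3 a4 a5 a6 a7, P (oct a0 a1 a2 a3 a4 a5 a6 a7)) ->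
  forall x, P x.
Proof.
move=> h x; suff -> : x =
    oct (qcoef (ofst x) 0) (qcoef (ofst x) 1) (qcoef (ofst x) 2)
        (qcoef (ofst x) 3) (qcoef (osnd x) 0) (qcoef (osnd x) 1)
        (qcoef (osnd x) 2) (qcoef (osnd x) 3) by [].
by apply: octP; rewrite /oct !octE; apply: quatP; rewrite !octE.
Qed.

Lemma quatD a0 a1 a2 a3 b0 b1 b2 b3 : quat a0 a1 a2 a3 + quat b0 b1 b2 b3 =
  quat (a0 + b0) (a1 + b1) (a2 + b2) (a3 + b3) :> 'cV[R]_4.
Proof. by apply: quatP; rewrite !octE. Qed.
Lemma quatN a0 a1 a2 a3 : - quat a0 a1 a2 a3 =
  quat (- a0) (- a1) (- a2) (- a3) :> 'cV[R]_4.
Proof. by apply: quatP; rewrite !octE. Qed.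
Lemma quatM a0 a1 a2 a3 b0 b1 b2 b3 :
  qmul (quat a0 a1 a2 a3) (quat b0 b1 b2 b3) =
  quat (a0 * b0 - a1 * b1 - a2 * b2 - a3 * b3)
       (a0 * b1 + a1 * b0 + a2 * b3 - a3 * b2)
       (a0 * b2 - a1 * b3 + a2 * b0 + a3 * b1)
       (a0 * b3 + a1 * b2 - a2 * b1 + a3 * b0) :> 'cV[R]_4.
Proof. by rewrite /qmul !qcoef_quat. Qed.
Lemma quat_conj a0 a1 a2 a3 :
  qconj (quat a0 a1 a2 a3) = quat a0 (- a1) (- a2) (- a3) :> 'cV[R]_4.
Proof. by rewrite /qconj !qcoef_quat. Qed.

Lemma octD a0 a1 a2 a3 a4 a5 a6 a7 b0 b1 b2 b3 b4 b5 b6 b7 :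
  oct a0 a1 a2 a3 a4 a5 a6 a7 + oct b0 b1 b2 b3 b4 b5 b6 b7 =
  oct (a0 + b0) (a1 + b1) (a2 + b2) (a3 + b3)
      (a4 + b4) (a5 + b5) (a6 + b6) (a7 + b7).
Proof.
by apply: octP; rewrite /oct ?(ofstD, osndD, ofst_pair, osnd_pair) quatD.
Qed.
Lemma octN a0 a1 a2 a3 a4 a5 a6 a7 :
  - oct a0 a1 a2 a3 a4 a5 a6 a7 =
  oct (- a0) (- a1) (- a2) (- a3) (- a4) (- a5) (- a6) (- a7).
Proof.
by apply: octP; rewrite /oct ?(ofstN, osndN, ofst_pair, osnd_pair) quatN.
Qed.
Lemma octZ r a0 a1 a2 a3 a4 a5 a6 a7 :
  r *: oct a0 a1 a2 a3 a4 a5 a6 a7 =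
  oct (r * a0) (r * a1) (r * a2) (r * a3) (r * a4) (r * a5) (r * a6) (r * a7).
Proof.
by apply: octP; rewrite /oct ?(ofstZ, osndZ, ofst_pair, osnd_pair);
  apply: quatP; rewrite qcoefZ !qcoef_quat.
Qed.
Lemma oct0 : 0 = oct 0 0 0 0 0 0 0 0.
Proof. by apply: octP; rewrite /oct !octE; apply: quatP; rewrite !octE. Qed.
Lemma oct1 : oone = oct 1 0 0 0 0 0 0 0.
Proof. by apply: octP; rewrite /oct !octE; apply: quatP; rewrite !octE. Qed.
Lemma oct_conj a0 a1 a2 a3 a4 a5 a6 a7 :
  oconj (oct a0 a1 a2 a3 a4 a5 a6 a7) =
  oct a0 (- a1) (- a2) (- a3) (- a4) (- a5) (- a6) (- a7).
Proof. by rewrite /oconj /oct ofst_pair osnd_pair quat_conj quatN. Qed.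
Lemma oct_mul a0 a1 a2 a3 a4 a5 a6 a7 b0 b1 b2 b3 b4 b5 b6 b7 :
  omul (oct a0 a1 a2 a3 a4 a5 a6 a7) (oct b0 b1 b2 b3 b4 b5 b6 b7) =
  oct (a0 * b0 - a1 * b1 - a2 * b2 - a3 * b3
         - a4 * b4 - a5 * b5 - a6 * b6 - a7 * b7)
      (a0 * b1 + a1 * b0 + a2 * b3 - a3 * b2
         + a4 * b5 - a5 * b4 - a6 * b7 + a7 * b6)
      (a0 * b2 - a1 * b3 + a2 * b0 + a3 * b1
         + a4 * b6 + a5 * b7 - a6 * b4 - a7 * b5)
      (a0 * b3 + a1 * b2 - a2 * b1 + a3 * b0
         + a4 * b7 - a5 * b6 + a6 * b5 - a7 * b4)
      (a0 * b4 - a1 * b5 - a2 * b6 - a3 * b7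
         + a4 * b0 + a5 * b1 + a6 * b2 + a7 * b3)
      (a0 * b5 + a1 * b4 - a2 * b7 + a3 * b6
         - a4 * b1 + a5 * b0 - a6 * b3 + a7 * b2)
      (a0 * b6 + a1 * b7 + a2 * b4 - a3 * b5
         - a4 * b2 + a5 * b3 + a6 * b0 - a7 * b1)
      (a0 * b7 - a1 * b6 + a2 * b5 + a3 * b4
         - a4 * b3 - a5 * b2 + a6 * b1 + a7 * b0).
Proof.
rewrite /omul /oct !ofst_pair !osnd_pair !quat_conj !quatM !quatN !quatD.
congr (opair (quat _ _ _ _) (quat _ _ _ _)); ring.
Qed.
Lemma oct_dot a0 a1 a2 a3 a4 a5 a6 a7 b0 b1 b2 b3 b4 b5 b6 b7 :
  odot (oct a0 a1 a2 a3 a4 a5 a6 a7) (oct b0 b1 b2 b3 b4 b5 b6 b7) =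
  a0 * b0 + a1 * b1 + a2 * b2 + a3 * b3 + a4 * b4 + a5 * b5 + a6 * b6 + a7 * b7.
Proof.
rewrite /odot oct_conj oct_mul oReE ofst_pair qcoef_quat; ring.
Qed.
Lemma oct_re a0 a1 a2 a3 a4 a5 a6 a7 : oRe (oct a0 a1 a2 a3 a4 a5 a6 a7) = a0.
Proof. by rewrite oReE ofst_pair qcoef_quat. Qed.

Definition octS := (octD, octN, octZ, oct_conj, oct_mul, oct_dot, oct_re).

Lemma oct_eq (x y : O) a0 a1 a2 a3 a4 a5 a6 a7 b0 b1 b2 b3 b4 b5 b6 b7 :
  x = oct a0 a1 a2 a3 a4 a5 a6 a7 -> y = oct b0 b1 b2 b3 b4 b5 b6 b7 ->
  a0 = b0 -> a1 = b1 -> a2 = b2 -> a3 = b3 ->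
  a4 = b4 -> a5 = b5 -> a6 = b6 -> a7 = b7 -> x = y.
Proof. by move=> -> ->; do 8!move=> ->. Qed.

(** This rule and the next ones take coordinate forms of the arguments as premises, so that
    [octnorm] can build the coordinates of a compound term through existential variables, following
    its syntax. *)
Lemma octD_eq (x y : O) a0 a1 a2 a3 a4 a5 a6 a7 b0 b1 b2 b3 b4 b5 b6 b7 :
  x = oct a0 a1 a2 a3 a4 a5 a6 a7 -> y = oct b0 b1 b2 b3 b4 b5 b6 b7 ->
  x + y = oct (a0 + b0) (a1 + b1) (a2 + b2) (a3 + b3)
              (a4 + b4) (a5 + b5) (a6 + b6) (a7 + b7).
Proof. by move=> -> ->; exact: octD. Qed.
Lemma octN_eq (x : O) a0 a1 a2 a3 a4 a5 a6 a7 :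
  x = oct a0 a1 a2 a3 a4 a5 a6 a7 ->
  - x = oct (- a0) (- a1) (- a2) (- a3) (- a4) (- a5) (- a6) (- a7).
Proof. by move=> ->; exact: octN. Qed.
Lemma octZ_eq r (x : O) a0 a1 a2 a3 a4 a5 a6 a7 :
  x = oct a0 a1 a2 a3 a4 a5 a6 a7 ->
  r *: x = oct (r * a0) (r * a1) (r * a2) (r * a3)
               (r * a4) (r * a5) (r * a6) (r * a7).
Proof. by move=> ->; exact: octZ. Qed.
Lemma oct_conj_eq (x : O) a0 a1 a2 a3 a4 a5 a6 a7 :
  x = oct a0 a1 a2 a3 a4 a5 a6 a7 ->
  oconj x = oct a0 (- a1) (- a2) (- a3) (- a4) (- a5) (- a6) (- a7).
Proof. by move=> ->; exact: oct_conj. Qed.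
Lemma oct_mul_eq (x y : O) a0 a1 a2 a3 a4 a5 a6 a7 b0 b1 b2 b3 b4 b5 b6 b7 :
  x = oct a0 a1 a2 a3 a4 a5 a6 a7 -> y = oct b0 b1 b2 b3 b4 b5 b6 b7 ->
  omul x y =
  oct (a0 * b0 - a1 * b1 - a2 * b2 - a3 * b3
         - a4 * b4 - a5 * b5 - a6 * b6 - a7 * b7)
      (a0 * b1 + a1 * b0 + a2 * b3 - a3 * b2
         + a4 * b5 - a5 * b4 - a6 * b7 + a7 * b6)
      (a0 * b2 - a1 * b3 + a2 * b0 + a3 * b1
         + a4 * b6 + a5 * b7 - a6 * b4 - a7 * b5)
      (a0 * b3 + a1 * b2 - a2 * b1 + a3 * b0
         + a4 * b7 - a5 * b6 + a6 * b5 - a7 * b4)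
      (a0 * b4 - a1 * b5 - a2 * b6 - a3 * b7
         + a4 * b0 + a5 * b1 + a6 * b2 + a7 * b3)
      (a0 * b5 + a1 * b4 - a2 * b7 + a3 * b6
         - a4 * b1 + a5 * b0 - a6 * b3 + a7 * b2)
      (a0 * b6 + a1 * b7 + a2 * b4 - a3 * b5
         - a4 * b2 + a5 * b3 + a6 * b0 - a7 * b1)
      (a0 * b7 - a1 * b6 + a2 * b5 + a3 * b4
         - a4 * b3 - a5 * b2 + a6 * b1 + a7 * b0).
Proof. by move=> -> ->; exact: oct_mul. Qed.
Lemma oct_dot_eq (x y : O) a0 a1 a2 a3 a4 a5 a6 a7 b0 b1 b2 b3 b4 b5 b6 b7 :
  x = oct a0 a1 a2 a3 a4 a5 a6 a7 -> y = oct b0 b1 b2 b3 b4 b5 b6 b7 ->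
  odot x y = a0 * b0 + a1 * b1 + a2 * b2 + a3 * b3 +
             a4 * b4 + a5 * b5 + a6 * b6 + a7 * b7.
Proof. by move=> -> ->; exact: oct_dot. Qed.
Lemma oct_re_eq (x : O) a0 a1 a2 a3 a4 a5 a6 a7 :
  x = oct a0 a1 a2 a3 a4 a5 a6 a7 -> oRe x = a0.
Proof. by move=> ->; exact: oct_re. Qed.

Lemma ocoef_lo (x : O) k : (k < 4)%N -> x (inord k) ord0 = qcoef (ofst x) k.
Proof.
move=> k4; rewrite /qcoef mxE; congr (x _ _); apply/val_inj.
by rewrite /= !inordK // (leq_trans k4).
Qed.
Lemma ocoef_hi (x : O) k : (k < 4)%N ->
  x (inord (4 + k)) ord0 = qcoef (osnd x) k.
Proof.
move=> k4; rewrite /qcoef mxE; congr (x _ _); apply/val_inj.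
by rewrite /= !inordK // ltn_add2l.
Qed.

Lemma oct_coef a0 a1 a2 a3 a4 a5 a6 a7 k : (k < 8)%N ->
  oct a0 a1 a2 a3 a4 a5 a6 a7 (inord k) ord0 =
  nth 0 [:: a0; a1; a2; a3; a4; a5; a6; a7] k.
Proof.
case: k => [|[|[|[|k]]]] hk;
  try by rewrite ocoef_lo // ofst_pair qcoef_quat.
have k4 : (k < 4)%N by [].
rewrite -[k.+4]/(4 + k)%N ocoef_hi // osnd_pair.
by case: k k4 {hk} => [|[|[|[|k]]]] // _; rewrite qcoef_quat.
Qed.
End OctonionCoordinates.

(** * Reduction of octonion identities to polynomial ones *)

Lemma h1_congr (R : realType) (a b c a' b' c' : R) (x y z x' y' z' : 'cV[R]_8) :
  a = a' -> b = b' -> c = c' -> x = x' -> y = y' -> z = z' ->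
  h1 a b c x y z = h1 a' b' c' x' y' z'.
Proof. by do 6!move=> ->. Qed.

Ltac octgen := repeat match goal with x : 'cV[_]_8 |- _ =>
  move: x; apply: oct_ind => ? ? ? ? ? ? ? ? end.

Ltac octnorm := lazymatch goal with
  | |- omul _ _ = _ => eapply oct_mul_eq; octnorm
  | |- oconj _ = _ => eapply oct_conj_eq; octnorm
  | |- _ + _ = _ => eapply octD_eq; octnorm
  | |- - _ = _ => eapply octN_eq; octnorm
  | |- _ *: _ = _ => eapply octZ_eq; octnorm
  | |- oone = _ => exact: oct1
  | |- 0 = _ => exact: oct0
  | |- oct _ _ _ _ _ _ _ _ = _ => reflexivity
  end.

Ltac octscalars := repeat match goal with
  | |- context [odot ?x ?y] =>
      erewrite (@oct_dot_eq _ x y); [|octnorm|octnorm]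
  | |- context [oRe ?x] => erewrite (@oct_re_eq _ x); [|octnorm]
  end.

Ltac octexpand :=
  octgen; octscalars; try (eapply oct_eq; [octnorm|octnorm|..]).
Ltac octring := octexpand; ring.
Ltac octfield := octexpand; by field.

(** * The Jordan algebra in coordinates *)

Section JordanCoordinates.
Context {R : realType}.

Notation O := 'cV[R]_8.
Notation J := 'cV[R]_27.

Lemma omulNr (x y : O) : omul x (- y) = - omul x y.
Proof. octring. Qed.
Lemma omul1x (x : O) : omul oone x = x.
Proof. octring. Qed.
Lemma omulx1 (x : O) : omul x oone = x.
Proof. octring. Qed.
Lemma oconj0 : oconj 0 = 0 :> O.
Proof. octring. Qed.

Lemma odotDl (x y z : O) : odot (x + y) z = odot x z + odot y z.
Proof. octring. Qed.
Lemma odotZl r (x y : O) : odot (r *: x) y = r * odot x y.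
Proof. octring. Qed.
Lemma odotNl (x y : O) : odot (- x) y = - odot x y.
Proof. octring. Qed.
Lemma odotNr (x y : O) : odot x (- y) = - odot x y.
Proof. octring. Qed.
Lemma odot0l (x : O) : odot 0 x = 0.
Proof. octring. Qed.
Lemma odot0r (x : O) : odot x 0 = 0.
Proof. octring. Qed.
Lemma odot_conj (x y : O) : odot (oconj x) (oconj y) = odot x y.
Proof. octring. Qed.
Lemma odot1l (x : O) : odot oone x = oRe x.
Proof. octring. Qed.

Lemma odot_ge0 (x : O) : 0 <= odot x x.
Proof. by octgen; rewrite octS -!expr2 !addr_ge0 ?sqr_ge0. Qed.

Lemma odot_eq0 (x : O) : odot x x = 0 -> x = 0.
Proof.
octgen; rewrite octS -!expr2 => /eqP.
rewrite !paddr_eq0 ?addr_ge0 ?sqr_ge0 // !sqrf_eq0 oct0.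
by do 7![case/andP]; do 8!move=> /eqP ->.
Qed.

Lemma odot_inj (x y : O) : (forall z, odot x z = odot y z) -> x = y.
Proof.
move=> e; apply/eqP; rewrite -subr_eq0; apply/eqP/odot_eq0.
by rewrite {1}odotDl odotNl e subrr.
Qed.

Lemma obaseE k : (k < 8)%N -> obase (inord k) = oct (k == 0)%:R (k == 1)%:R
  (k == 2)%:R (k == 3)%:R (k == 4)%:R (k == 5)%:R (k == 6)%:R (k == 7)%:R :> O.
Proof.
move=> hk; apply/matrixP => i j; rewrite ord1 -[i]inord_val oct_coef //.
rewrite mxE eqxx andbT -val_eqE /= !inordK // eq_sym.
by case: i => [[|[|[|[|[|[|[|[|i]]]]]]]] hi].
Qed.

Lemma odot_obase (x : O) i : odot x (obase i) = x i ord0.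
Proof.
move: x; apply: oct_ind => a0 a1 a2 a3 a4 a5 a6 a7.
rewrite -[i]inord_val obaseE // oct_coef // octS.
by case: i => [[|[|[|[|[|[|[|[|i]]]]]]]] hi] //=; ring.
Qed.

Lemma jxi1D (X Y : J) : jxi1 (X + Y) = jxi1 X + jxi1 Y.
Proof. by rewrite /jxi1 /jxi !mxE. Qed.
Lemma jxi2D (X Y : J) : jxi2 (X + Y) = jxi2 X + jxi2 Y.
Proof. by rewrite /jxi2 /jxi !mxE. Qed.
Lemma jxi3D (X Y : J) : jxi3 (X + Y) = jxi3 X + jxi3 Y.
Proof. by rewrite /jxi3 /jxi !mxE. Qed.
Lemma jx1D (X Y : J) : jx1 (X + Y) = jx1 X + jx1 Y.
Proof. by apply/matrixP => i j; rewrite !mxE. Qed.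
Lemma jx2D (X Y : J) : jx2 (X + Y) = jx2 X + jx2 Y.
Proof. by apply/matrixP => i j; rewrite !mxE. Qed.
Lemma jx3D (X Y : J) : jx3 (X + Y) = jx3 X + jx3 Y.
Proof. by apply/matrixP => i j; rewrite !mxE. Qed.
Lemma jxi1Z r (X : J) : jxi1 (r *: X) = r * jxi1 X.
Proof. by rewrite /jxi1 /jxi !mxE. Qed.
Lemma jxi2Z r (X : J) : jxi2 (r *: X) = r * jxi2 X.
Proof. by rewrite /jxi2 /jxi !mxE. Qed.
Lemma jxi3Z r (X : J) : jxi3 (r *: X) = r * jxi3 X.
Proof. by rewrite /jxi3 /jxi !mxE. Qed.
Lemma jx1Z r (X : J) : jx1 (r *: X) = r *: jx1 X.
Proof. by apply/matrixP => i j; rewrite !mxE. Qed.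
Lemma jx2Z r (X : J) : jx2 (r *: X) = r *: jx2 X.
Proof. by apply/matrixP => i j; rewrite !mxE. Qed.
Lemma jx3Z r (X : J) : jx3 (r *: X) = r *: jx3 X.
Proof. by apply/matrixP => i j; rewrite !mxE. Qed.

Lemma h1D a b c (x y z : O) a' b' c' x' y' z' :
  h1 a b c x y z + h1 a' b' c' x' y' z' =
  h1 (a + a') (b + b') (c + c') (x + x') (y + y') (z + z') :> J.
Proof.
by rewrite [LHS]h1_eta !(jxi1D, jxi2D, jxi3D, jx1D, jx2D, jx3D) !h1E.
Qed.

Lemma h1Z r a b c (x y z : O) : r *: h1 a b c x y z =
  h1 (r * a) (r * b) (r * c) (r *: x) (r *: y) (r *: z) :> J.
Proof.
by rewrite [LHS]h1_eta !(jxi1Z, jxi2Z, jxi3Z, jx1Z, jx2Z, jx3Z) !h1E.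
Qed.

Lemma h1N a b c (x y z : O) : - h1 a b c x y z =
  h1 (- a) (- b) (- c) (- x) (- y) (- z) :> J.
Proof. by rewrite -scaleN1r h1Z !mulN1r !scaleN1r. Qed.

Lemma h10 : h1 0 0 0 0 0 0 = 0 :> J.
Proof. by rewrite -[in RHS](scale0r (h1 0 0 0 0 0 0)) h1Z !mulr0 !scaler0. Qed.

#[local] Opaque omul oconj odot oRe.

Lemma jmat_h1 a b c (x y z : O) : jmat (h1 a b c x y z) =
  mat3 [:: [:: oc_re (a *: oone); oc_im z; oc_im (oconj y)];
           [:: oc_im (oconj z); oc_re (b *: oone); oc_re x];
           [:: oc_im y; oc_re (oconj x); oc_re (c *: oone)]].
Proof. by rewrite /jmat !h1E. Qed.

(** This formula replaces the matrices over the complexified octonions from here on. Its minus signs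
    are sqrt(-1)^2: the entries [x2] and [x3] carry a factor sqrt(-1), the entry [x1] does not. *)
Lemma jmul_h1 a1 a2 a3 (x1 x2 x3 : O) b1 b2 b3 (y1 y2 y3 : O) :
  jmul (h1 a1 a2 a3 x1 x2 x3) (h1 b1 b2 b3 y1 y2 y3) =
  h1 (a1 * b1 - odot x2 y2 - odot x3 y3)
     (a2 * b2 + odot x1 y1 - odot x3 y3)
     (a3 * b3 + odot x1 y1 - odot x2 y2)
     (2^-1 *: ((a2 + a3) *: y1 + (b2 + b3) *: x1 -
        oconj (omul y2 x3) - oconj (omul x2 y3)))
     (2^-1 *: ((a3 + a1) *: y2 + (b3 + b1) *: x2 +
        oconj (omul y3 x1) + oconj (omul x3 y1)))
     (2^-1 *: ((a1 + a2) *: y3 + (b1 + b2) *: x3 +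
        oconj (omul y1 x2) + oconj (omul x1 y2))).
Proof.
rewrite /jmul !jmat_h1 /jcoord.
apply: h1_congr; rewrite jordan_mxE !ocmulmxE !mat3E // /ocmul /oc_re /oc_im /=.
all: octfield.
Qed.

End JordanCoordinates.

(* Locked copies: failing unification attempts would otherwise unfold matrix
   products of size 27 and octonion products. *)
Definition jprod (R : realType) (X Y : 'cV[R]_27) : 'cV[R]_27 :=
  locked (@jmul R) X Y.
Definition bil (R : realType) (X Y : 'cV[R]_27) : R :=
  locked (fun X Y => jtr (jprod X Y)) X Y.
Definition ap (R : realType) (T : 'M[R]_27) (X : 'cV[R]_27) : 'cV[R]_27 :=
  locked (fun T X => T *m X) T X.
Notation "T $ X" := (ap T X) (at level 40, left associativity) : ring_scope.

Lemma apE (R : realType) (T : 'M[R]_27) (X : 'cV[R]_27) : T *m X = T $ X.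
Proof. by rewrite /ap -lock. Qed.

Lemma jprodE (R : realType) (X Y : 'cV[R]_27) : jmul X Y = jprod X Y.
Proof. by rewrite /jprod -lock. Qed.
Lemma bilE (R : realType) (X Y : 'cV[R]_27) : jform X Y = bil X Y.
Proof. by rewrite /jform /bil -lock jprodE. Qed.

Lemma jprod_h1 (R : realType) a1 a2 a3 (x1 x2 x3 : 'cV[R]_8)
    b1 b2 b3 (y1 y2 y3 : 'cV[R]_8) :
  jprod (h1 a1 a2 a3 x1 x2 x3) (h1 b1 b2 b3 y1 y2 y3) =
  h1 (a1 * b1 - odot x2 y2 - odot x3 y3)
     (a2 * b2 + odot x1 y1 - odot x3 y3)
     (a3 * b3 + odot x1 y1 - odot x2 y2)
     (2^-1 *: ((a2 + a3) *: y1 + (b2 + b3) *: x1 -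
        oconj (omul y2 x3) - oconj (omul x2 y3)))
     (2^-1 *: ((a3 + a1) *: y2 + (b3 + b1) *: x2 +
        oconj (omul y3 x1) + oconj (omul x3 y1)))
     (2^-1 *: ((a1 + a2) *: y3 + (b1 + b2) *: x3 +
        oconj (omul y1 x2) + oconj (omul x1 y2))).
Proof. by rewrite -jprodE jmul_h1. Qed.

Lemma h1_ind (R : realType) (P : 'cV[R]_27 -> Prop) :
  (forall a b c x y z, P (h1 a b c x y z)) -> forall X, P X.
Proof. by move=> h X; rewrite [X]h1_eta. Qed.

Ltac jgen := repeat match goal with X : 'cV[_]_27 |- _ =>
  move: X; apply: h1_ind => ? ? ? ? ? ? end.
Ltac jlin := let r := fresh "r" in move=> r;
  apply: h1_ind => ? ? ? ? ? ?; apply: h1_ind => ? ? ? ? ? ?; jgen;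
  rewrite !(h1D, h1Z, h1E); apply: h1_congr; octring.

(** * The Lie algebra operators in coordinates *)

Section Operators.
Context {R : realType}.

Notation O := 'cV[R]_8.
Notation J := 'cV[R]_27.

Lemma A1E (u : O) a b c x y z : A1 u $ h1 a b c x y z =
  h1 0 (2 * odot u x) (- (2 * odot u x)) (- ((b - c) *: u))
     (- oconj (omul z u)) (oconj (omul u y)).
Proof. rewrite -apE lmxE ?h1E //; jlin. Qed.

Lemma A2E (u : O) a b c x y z : A2 u $ h1 a b c x y z =
  h1 (2 * odot u y) 0 (- (2 * odot u y)) (- oconj (omul u z))
     (- ((c - a) *: u)) (- oconj (omul x u)).
Proof. rewrite -apE lmxE ?h1E //; jlin. Qed.

Lemma A3E (u : O) a b c x y z : A3 u $ h1 a b c x y z =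
  h1 (- (2 * odot u z)) (2 * odot u z) 0
     (oconj (omul y u)) (oconj (omul u x)) (- ((a - b) *: u)).
Proof. rewrite -apE lmxE ?h1E //; jlin. Qed.

Lemma odeltaE (p : O) a b c x y z : odelta p $ h1 a b c x y z =
  h1 0 0 0 (omul p x) (omul y p) (- (omul p z + omul z p)).
Proof. rewrite -apE lmxE ?h1E //; jlin. Qed.

Lemma sigmaE a b c (x y z : O) :
  sigma $ h1 a b c x y z = h1 a b c x (- y) (- z).
Proof. rewrite -apE lmxE ?h1E //; jlin. Qed.

Lemma Gm1E (u : O) a b c x y z : Gm1 u $ h1 a b c x y z =
  h1 (2 * odot (oconj u) y) (2 * odot u x)
     (- (2 * odot u x) - (2 * odot (oconj u) y))
     (- ((b - c) *: u) - oconj (omul (oconj u) z))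
     (- oconj (omul z u) - ((c - a) *: oconj u))
     (oconj (omul u y) - oconj (omul x (oconj u))).
Proof. by rewrite -apE mulmxDl !apE A1E A2E h1D add0r addr0. Qed.

Lemma Gm2E (p : O) a b c x y z : Gm2 p $ h1 a b c x y z =
  h1 (- (2 * odot p z)) (2 * odot p z) 0
     (oconj (omul y p) - omul p x) (oconj (omul p x) - omul y p)
     (- ((a - b) *: p) + (omul p z + omul z p)).
Proof.
by rewrite -apE mulmxDl mulNmx !apE A3E odeltaE h1N h1D !oppr0 !addr0 opprK.
Qed.

Lemma apDl (S T : 'M[R]_27) (X : J) : (S + T) $ X = S $ X + T $ X.
Proof. by rewrite -!apE mulmxDl. Qed.
Lemma apNl (T : 'M[R]_27) (X : J) : (- T) $ X = - (T $ X).
Proof. by rewrite -!apE mulNmx. Qed.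
Lemma apZl r (T : 'M[R]_27) (X : J) : (r *: T) $ X = r *: (T $ X).
Proof. by rewrite -!apE -scalemxAl. Qed.
Lemma apDr (T : 'M[R]_27) (X Y : J) : T $ (X + Y) = T $ X + T $ Y.
Proof. by rewrite -!apE mulmxDr. Qed.
Lemma apNr (T : 'M[R]_27) (X : J) : T $ (- X) = - (T $ X).
Proof. by rewrite -!apE mulmxN. Qed.
Lemma apZr r (T : 'M[R]_27) (X : J) : T $ (r *: X) = r *: (T $ X).
Proof. by rewrite -!apE -scalemxAr. Qed.
Lemma ap0r (T : 'M[R]_27) : T $ 0 = 0.
Proof. by rewrite -!apE mulmx0. Qed.
Lemma mulJ (S T : 'M[R]_27) (X : J) : (S * T) $ X = S $ (T $ X).
Proof. rewrite -!apE; exact: esym (mulmxA _ _ _). Qed.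
Lemma mul1J (X : J) : (1 : 'M[R]_27) $ X = X.
Proof. rewrite -apE; exact: mul1mx. Qed.

Lemma jprod_linearr (X : J) : linear (jprod X).
Proof.
move=> r; apply: h1_ind => ? ? ? ? ? ?; apply: h1_ind => ? ? ? ? ? ?; jgen.
rewrite !(h1D, h1Z, jprod_h1); apply: h1_congr; octring.
Qed.

Lemma jprodC (X Y : J) : jprod X Y = jprod Y X.
Proof. jgen; rewrite !jprod_h1; apply: h1_congr; octring. Qed.

Definition derivation (T : 'M[R]_27) :=
  forall X Y : J, T $ jprod X Y = jprod (T $ X) Y + jprod X (T $ Y).

End Operators.

#[local] Opaque omul oconj odot oRe.

(** * The generating operators are derivations *)

Section BasicDerivations.
Context {R : realType}.

Notation O := 'cV[R]_8.

Lemma derivation_A1 (u : O) : derivation (A1 u).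
Proof.
move=> X Y; jgen; rewrite jprod_h1 !A1E !jprod_h1 h1D.
apply: h1_congr; octfield.
Qed.

Lemma derivation_A2 (u : O) : derivation (A2 u).
Proof.
move=> X Y; jgen; rewrite jprod_h1 !A2E !jprod_h1 h1D.
apply: h1_congr; octfield.
Qed.

Lemma derivation_A3 (u : O) : derivation (A3 u).
Proof.
move=> X Y; jgen; rewrite jprod_h1 !A3E !jprod_h1 h1D.
apply: h1_congr; octfield.
Qed.

(** Infinitesimal triality: the Moufang identity (px)(yp) = p(xy)p, linearized at p = 1, gives (px)y
    + x(yp) = p(xy) + (xy)p. The third component of [odelta] is its conjugate, with the sign coming
    from conj p = -p for imaginary p. *)
Lemma derivation_odelta (u : O) : oRe u = 0 -> derivation (odelta u).
Proof.
move: u; apply: oct_ind => u0 ? ? ? ? ? ? ?; rewrite oct_re => -> X Y; jgen.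
rewrite jprod_h1 !odeltaE !jprod_h1 h1D.
apply: h1_congr; octfield.
Qed.

End BasicDerivations.

(** * The trace form, and traces of multiplication operators *)

Section TraceForm.
Context {R : realType}.

Notation O := 'cV[R]_8.
Notation J := 'cV[R]_27.
Notation L := 'M[R]_27.

Lemma jtr_h1 a b c (x y z : O) : jtr (h1 a b c x y z) = a + b + c.
Proof. by rewrite /jtr !h1E. Qed.

Lemma bil_h1 a1 a2 a3 (x1 x2 x3 : O) b1 b2 b3 (y1 y2 y3 : O) :
  bil (h1 a1 a2 a3 x1 x2 x3) (h1 b1 b2 b3 y1 y2 y3) =
  a1 * b1 + a2 * b2 + a3 * b3 +
  2 * odot x1 y1 - 2 * odot x2 y2 - 2 * odot x3 y3.
Proof. by rewrite /bil -lock jprod_h1 jtr_h1; ring. Qed.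

Lemma jtrD (X Y : J) : jtr (X + Y) = jtr X + jtr Y.
Proof. by rewrite /jtr jxi1D jxi2D jxi3D; ring. Qed.
Lemma jtrZ r (X : J) : jtr (r *: X) = r * jtr X.
Proof. by rewrite /jtr jxi1Z jxi2Z jxi3Z; ring. Qed.

Lemma bilC (X Y : J) : bil X Y = bil Y X.
Proof. by rewrite /bil -!lock jprodC. Qed.
Lemma jprodDr (X Y Z : J) : jprod X (Y + Z) = jprod X Y + jprod X Z.
Proof. by have := jprod_linearr X 1 Y Z; rewrite !scale1r. Qed.
Lemma jprod0r (X : J) : jprod X 0 = 0.
Proof.
by have := jprod_linearr X (-1) 0 0; rewrite scaler0 addr0 scaleN1r addNr.
Qed.
Lemma jprodZr r (X Y : J) : jprod X (r *: Y) = r *: jprod X Y.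
Proof. by have := jprod_linearr X r Y 0; rewrite !addr0 jprod0r addr0. Qed.
Lemma jprodDl (X Y Z : J) : jprod (X + Y) Z = jprod X Z + jprod Y Z.
Proof. by rewrite ![jprod _ Z]jprodC jprodDr. Qed.
Lemma jprodZl r (X Y : J) : jprod (r *: X) Y = r *: jprod X Y.
Proof. by rewrite ![jprod _ Y]jprodC jprodZr. Qed.
Lemma jprod0l (X : J) : jprod 0 X = 0.
Proof. by rewrite jprodC jprod0r. Qed.
Lemma bilDr (X Y Z : J) : bil X (Y + Z) = bil X Y + bil X Z.
Proof. by rewrite /bil -!lock jprodDr jtrD. Qed.
Lemma bilDl (X Y Z : J) : bil (X + Y) Z = bil X Z + bil Y Z.
Proof. by rewrite /bil -!lock jprodDl jtrD. Qed.
Lemma bilZr r (X Y : J) : bil X (r *: Y) = r * bil X Y.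
Proof. by rewrite /bil -!lock jprodZr jtrZ. Qed.
Lemma bilZl r (X Y : J) : bil (r *: X) Y = r * bil X Y.
Proof. by rewrite /bil -!lock jprodZl jtrZ. Qed.
Lemma bilNr (X Y : J) : bil X (- Y) = - bil X Y.
Proof. by rewrite -scaleN1r bilZr mulN1r. Qed.

Lemma bil_inj (X Y : J) : (forall Z, bil X Z = bil Y Z) -> X = Y.
Proof.
jgen => h.
apply: h1_congr.
- by have := h (h1 1 0 0 0 0 0); rewrite !bil_h1 !odot0r; lra.
- by have := h (h1 0 1 0 0 0 0); rewrite !bil_h1 !odot0r; lra.
- by have := h (h1 0 0 1 0 0 0); rewrite !bil_h1 !odot0r; lra.
- apply: odot_inj => z.
  by have := h (h1 0 0 0 z 0 0); rewrite !bil_h1 !odot0r; lra.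
- apply: odot_inj => z.
  by have := h (h1 0 0 0 0 z 0); rewrite !bil_h1 !odot0r; lra.
- apply: odot_inj => z.
  by have := h (h1 0 0 0 0 0 z); rewrite !bil_h1 !odot0r; lra.
Qed.

Lemma mx_ext (A B : L) : (forall X : J, A $ X = B $ X) -> A = B.
Proof.
move=> h; apply/matrixP => i j.
have := h (delta_mx j ord0); rewrite -!apE => /matrixP /(_ i ord0).
by rewrite -!colE !mxE.
Qed.

Lemma sum27 (V : nmodType) (F : 'I_27 -> V) : \sum_i F i =
  \sum_(i < 3) F (@lshift 3 24 i) +
  (\sum_(i < 8) F (@rshift 3 24 (@lshift 8 16 i)) +
  (\sum_(i < 8) F (@rshift 3 24 (@rshift 8 16 (@lshift 8 8 i))) +
   \sum_(i < 8) F (@rshift 3 24 (@rshift 8 16 (@rshift 8 8 i))))).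
Proof.
rewrite (@big_split_ord _ _ _ 3 24 xpredT); congr (_ + _).
rewrite (@big_split_ord _ _ _ 8 16 xpredT); congr (_ + _).
by rewrite (@big_split_ord _ _ _ 8 8 xpredT).
Qed.

Lemma delta_lshift m n (i : 'I_m) :
  delta_mx (lshift n i) ord0 = col_mx (delta_mx i ord0) 0 :> 'cV[R]_(m + n).
Proof.
apply/matrixP => k l; rewrite ord1; case: (split_ordP k) => k' ->.
  by rewrite col_mxEu !mxE (inj_eq (@lshift_inj _ _)).
by rewrite col_mxEd !mxE eq_rlshift.
Qed.
Lemma delta_rshift m n (i : 'I_n) :
  delta_mx (rshift m i) ord0 = col_mx 0 (delta_mx i ord0) :> 'cV[R]_(m + n).
Proof.
apply/matrixP => k l; rewrite ord1; case: (split_ordP k) => k' ->.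
  by rewrite col_mxEu !mxE eq_lrshift.
by rewrite col_mxEd !mxE (inj_eq (@rshift_inj _ _)).
Qed.

Lemma delta_xi (k : nat) : (k < 3)%N ->
  delta_mx (@lshift 3 24 (inord k)) ord0 =
  h1 (k == 0)%:R (k == 1)%:R (k == 2)%:R 0 0 0 :> J.
Proof.
move=> k3; apply: (etrans (@delta_lshift 3 24 _)); rewrite /h1 !col_mx0.
congr (@col_mx R 3 24 1 _ _); apply/matrixP => i j.
rewrite [j]ord1 !mxE eqxx andbT -val_eqE /= inordK // eq_sym.
by case: i => [[|[|[|i]]] hi].
Qed.
Lemma delta_x1 i : delta_mx (@rshift 3 24 (@lshift 8 16 i)) ord0 =
  h1 0 0 0 (obase i) 0 0 :> J.
Proof.
apply: (etrans (@delta_rshift 3 24 _)); rewrite /h1 !col_mx0.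
congr (@col_mx R 3 24 1 _ _); last exact: (@delta_lshift 8 16).
by apply/matrixP => -[[|[|[|k]]] hk] j; rewrite !mxE.
Qed.
Lemma delta_x2 i :
  delta_mx (@rshift 3 24 (@rshift 8 16 (@lshift 8 8 i))) ord0 =
  h1 0 0 0 0 (obase i) 0 :> J.
Proof.
apply: (etrans (@delta_rshift 3 24 _)); rewrite /h1.
congr (@col_mx R 3 24 1 _ _).
  by apply/matrixP => -[[|[|[|k]]] hk] j; rewrite !mxE.
apply: (etrans (@delta_rshift 8 16 _)).
congr (@col_mx R 8 16 1 _ _); exact: (@delta_lshift 8 8).
Qed.
Lemma delta_x3 i :
  delta_mx (@rshift 3 24 (@rshift 8 16 (@rshift 8 8 i))) ord0 =
  h1 0 0 0 0 0 (obase i) :> J.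
Proof.
apply: (etrans (@delta_rshift 3 24 _)); rewrite /h1.
congr (@col_mx R 3 24 1 _ _).
  by apply/matrixP => -[[|[|[|k]]] hk] j; rewrite !mxE.
apply: (etrans (@delta_rshift 8 16 _)).
congr (@col_mx R 8 16 1 _ _); exact: (@delta_rshift 8 8).
Qed.

Lemma mxtrace_J (T : L) : \tr T =
  jxi1 (T $ h1 1 0 0 0 0 0) + jxi2 (T $ h1 0 1 0 0 0 0) +
  jxi3 (T $ h1 0 0 1 0 0 0) +
  (\sum_(i < 8) jx1 (T $ h1 0 0 0 (obase i) 0 0) i ord0 +
  (\sum_(i < 8) jx2 (T $ h1 0 0 0 0 (obase i) 0) i ord0 +
   \sum_(i < 8) jx3 (T $ h1 0 0 0 0 0 (obase i)) i ord0)).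
Proof.
under [X in _ = _ + (X + _)]eq_bigr do rewrite -apE.
under [X in _ = _ + (_ + (X + _))]eq_bigr do rewrite -apE.
under [X in _ = _ + (_ + (_ + X))]eq_bigr do rewrite -apE.
have E k : T k k = (T *m (delta_mx k ord0 : J)) k ord0.
  rewrite mxE (bigD1 k) //= big1 ?addr0 => [|j jk];
    rewrite !mxE eqxx andbT ?eqxx ?mulr1 //.
  by rewrite (negbTE jk) mulr0.
rewrite /mxtrace -!apE sum27; congr (_ + (_ + (_ + _))).
- by rewrite sum_ord3 !E !delta_xi // /jxi1 /jxi2 /jxi3 /jxi !mxE.
- by apply: eq_bigr => i _; rewrite E delta_x1 /jx1 !mxE.
- by apply: eq_bigr => i _; rewrite E delta_x2 /jx2 !mxE.
- by apply: eq_bigr => i _; rewrite E delta_x3 /jx3 !mxE.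
Qed.

Lemma sum_obase (r : R) : \sum_(i < 8) (r *: obase i : O) i ord0 = 8 * r.
Proof.
rewrite (eq_bigr (fun=> r)) => [|i _]; last by rewrite !mxE !eqxx mulr1.
by rewrite sumr_const card_ord; ring.
Qed.

Definition Lmul (X : J) : L := locked (fun X => lmx (jprod X)) X.

Lemma LmulE X Y : Lmul X $ Y = jprod X Y.
Proof. by rewrite -apE /Lmul -lock; exact: lmxE (jprod_linearr X). Qed.

(** This makes the Jordan trace intrinsic to the product. The three diagonal coordinates contribute
    a + b + c, and the three blocks of dimension 8 contribute 4(b + c) + 4(c + a) + 4(a + b). *)
Lemma mxtrace_Lmul (X : J) : \tr (Lmul X) = 9 * jtr X.
Proof.
rewrite mxtrace_J !LmulE.
move: X; apply: h1_ind => a b c x y z.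
have E1 i : jx1 (Lmul (h1 a b c x y z) $ h1 0 0 0 (obase i) 0 0) =
    (2^-1 * (b + c)) *: obase i.
  rewrite LmulE jprod_h1 h1E !(omul0x, omulx0, oconj0, subr0).
  by rewrite addr0 scale0r addr0 scalerA.
have E2 i : jx2 (Lmul (h1 a b c x y z) $ h1 0 0 0 0 (obase i) 0) =
    (2^-1 * (c + a)) *: obase i.
  rewrite LmulE jprod_h1 h1E !(omul0x, omulx0, oconj0, subr0).
  by rewrite !addr0 scale0r addr0 scalerA.
have E3 i : jx3 (Lmul (h1 a b c x y z) $ h1 0 0 0 0 0 (obase i)) =
    (2^-1 * (a + b)) *: obase i.
  rewrite LmulE jprod_h1 h1E !(omul0x, omulx0, oconj0, subr0).
  by rewrite !addr0 scale0r addr0 scalerA.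
under eq_bigr do rewrite E1.
under [X in _ + (_ + (X + _))]eq_bigr do rewrite E2.
under [X in _ + (_ + (_ + X))]eq_bigr do rewrite E3.
by rewrite !sum_obase !jprod_h1 !h1E jtr_h1 !odot0r; field.
Qed.

(** As for [Lmul X], except that sigma reverses the signs of the blocks [x2] and [x3]; the blocks
    then add up to 4(b + c) - 4(c + a) - 4(a + b) = -8a, which singles out the first coordinate. *)
Lemma mxtrace_Lmul_sigma (X : J) :
  \tr (Lmul X * sigma) = jtr X - 8 * jxi1 X.
Proof.
rewrite mxtrace_J !mulJ !sigmaE !oppr0 !LmulE.
move: X; apply: h1_ind => a b c x y z.
have E1 i : jx1 ((Lmul (h1 a b c x y z) * sigma) $ h1 0 0 0 (obase i) 0 0) =
    (2^-1 * (b + c)) *: obase i.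
  rewrite mulJ sigmaE !oppr0 LmulE jprod_h1 h1E.
  rewrite !(omul0x, omulx0, oconj0, subr0).
  by rewrite addr0 scale0r addr0 scalerA.
have E2 i : jx2 ((Lmul (h1 a b c x y z) * sigma) $ h1 0 0 0 0 (obase i) 0) =
    (- (2^-1 * (c + a))) *: obase i.
  rewrite mulJ sigmaE !oppr0 LmulE jprod_h1 h1E.
  rewrite !(omul0x, omulx0, oconj0, subr0).
  by rewrite !addr0 scale0r addr0 !scalerN scalerA scaleNr.
have E3 i : jx3 ((Lmul (h1 a b c x y z) * sigma) $ h1 0 0 0 0 0 (obase i)) =
    (- (2^-1 * (a + b))) *: obase i.
  rewrite mulJ sigmaE !oppr0 LmulE jprod_h1 h1E.
  rewrite !(omul0x, omulx0, oconj0, subr0).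
  by rewrite !addr0 scale0r addr0 !scalerN scalerA scaleNr.
under eq_bigr do rewrite E1.
under [X in _ + (_ + (X + _))]eq_bigr do rewrite E2.
under [X in _ + (_ + (_ + X))]eq_bigr do rewrite E3.
by rewrite !sum_obase !jprod_h1 !h1E jtr_h1 !odot0r; field.
Qed.

End TraceForm.

(** * Automorphisms preserve the trace form; K fixes E_1 *)

Section Automorphisms.
Context {R : realType}.

Notation O := 'cV[R]_8.
Notation J := 'cV[R]_27.
Notation L := 'M[R]_27.

Implicit Types (g h : L) (X Y Z : J).

Lemma F4_unit g : F4 R g -> g \is a GRing.unit.
Proof. by case. Qed.
Lemma F4_jprod g X Y : F4 R g -> g $ jprod X Y = jprod (g $ X) (g $ Y).
Proof. by case=> _ /(_ X Y); rewrite !jprodE !apE. Qed.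

Lemma F4M g h : F4 R g -> F4 R h -> F4 R (g * h).
Proof.
move=> [gu gM] [hu hM]; split; first by rewrite unitrMl.
move=> X Y; by have := gM (h *m X) (h *m Y); rewrite -hM !jprodE !apE !mulJ.
Qed.

Lemma F4_mulVK g X : F4 R g -> g^-1 $ (g $ X) = X.
Proof. by move=> /F4_unit gu; rewrite -mulJ mulVr // mul1J. Qed.
Lemma F4_mulKV g X : F4 R g -> g $ (g^-1 $ X) = X.
Proof. by move=> /F4_unit gu; rewrite -mulJ mulrV // mul1J. Qed.

Lemma F4V g : F4 R g -> F4 R g^-1.
Proof.
move=> Fg; split; first by rewrite unitrV F4_unit.
move=> X Y; rewrite ?jprodE !apE -{1}[X](F4_mulKV _ Fg) -{1}[Y](F4_mulKV _ Fg).
by rewrite -F4_jprod // F4_mulVK.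
Qed.

Lemma sigmaK : sigma * sigma = 1 :> L.
Proof.
apply: mx_ext => X; rewrite mulJ mul1J; jgen.
by rewrite !sigmaE !opprK.
Qed.

Lemma sigma_unit : (sigma : L) \is a GRing.unit.
Proof. by apply/unitrP; exists sigma; rewrite sigmaK. Qed.
Lemma sigmaV : sigma^-1 = sigma :> L.
Proof. by rewrite -[RHS]mulr1 -(divrr sigma_unit) mulrA sigmaK mul1r. Qed.

Lemma F4_sigma : F4 R sigma.
Proof.
split=> [|X Y]; first exact: sigma_unit.
rewrite ?jprodE !apE; jgen; rewrite jprod_h1 !sigmaE jprod_h1.
apply: h1_congr; octring.
Qed.

Lemma F4_conj g X : F4 R g -> g * Lmul X = Lmul (g $ X) * g.
Proof. by move=> Fg; apply: mx_ext => Y; rewrite !mulJ !LmulE F4_jprod. Qed.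

(** [Lmul (g $ X)] is the conjugate of [Lmul X] by g, so the two have the same matrix trace. *)
Lemma F4_jtr g X : F4 R g -> jtr (g $ X) = jtr X.
Proof.
move=> Fg; apply: (@mulfI _ (9 : R)); first by rewrite pnatr_eq0.
rewrite -!mxtrace_Lmul.
rewrite -[Lmul X](mulKr (F4_unit Fg)) (F4_conj _ Fg) -[RHS]mxtrace_mulC.
by rewrite -[X in _ = \tr X]/(_ * _) mulrK ?F4_unit.
Qed.

Lemma F4_bil g X Y : F4 R g -> bil (g $ X) (g $ Y) = bil X Y.
Proof. by move=> Fg; rewrite /bil -!lock -F4_jprod // F4_jtr. Qed.

Lemma F4_bilV g X Y : F4 R g -> bil (g $ X) Y = bil X (g^-1 $ Y).
Proof. by move=> Fg; rewrite -[in LHS](F4_mulKV Y Fg) F4_bil. Qed.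

Lemma bil_E1 X : bil E1 X = jxi1 X.
Proof. by jgen; rewrite bil_h1 h1E !odot0l; ring. Qed.

(* tr (L_X sigma) = tr X - 8 xi_1 is invariant under K. *)
Lemma grK_E1 g : grK R g -> g $ E1 = E1.
Proof.
move=> [Fg sgs].
have gs : g * sigma = sigma * g by rewrite -{2}sgs !mulrA sigmaK mul1r.
have xi X : jxi1 (g $ X) = jxi1 X.
  have : \tr (Lmul (g $ X) * sigma) = \tr (Lmul X * sigma).
    rewrite -[Lmul X](mulKr (F4_unit Fg)) (F4_conj _ Fg) -mulrA.
    rewrite -(mulrA (Lmul (g $ X))) gs.
    rewrite (mulrA (Lmul _)) -[RHS]mxtrace_mulC -[X in _ = \tr X]/(_ * _).
    by rewrite mulrK ?F4_unit.
  rewrite !mxtrace_Lmul_sigma F4_jtr //; lra.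
apply: bil_inj => Y; rewrite F4_bilV // !bil_E1.
by rewrite -[in RHS](F4_mulKV Y Fg) xi.
Qed.

End Automorphisms.

(** * Exponentials of nilpotent derivations *)

Section Exponentials.
Context {R : realType}.

Notation J := 'cV[R]_27.
Notation L := 'M[R]_27.

Implicit Types (T : L) (X Y : J).

Lemma ap_sum T n (F : 'I_n -> J) : T $ (\sum_i F i) = \sum_i T $ F i.
Proof.
by rewrite (big_morph (ap T) (apDr T) (ap0r T)).
Qed.

Lemma jprod_suml n (F : 'I_n -> J) Y :
  jprod (\sum_i F i) Y = \sum_i jprod (F i) Y.
Proof.
have jD X Z : jprod (X + Z) Y = jprod X Y + jprod Z Y := jprodDl X Z Y.
by rewrite (big_morph (fun X => jprod X Y) jD (jprod0l Y)).
Qed.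
Lemma jprod_sumr n (F : 'I_n -> J) X :
  jprod X (\sum_i F i) = \sum_i jprod X (F i).
Proof. by rewrite (big_morph (jprod X) (jprodDr X) (jprod0r X)). Qed.

Lemma ap_suml n (F : 'I_n -> L) X : (\sum_i F i) $ X = \sum_i F i $ X.
Proof.
rewrite (big_morph (fun S => ap S X) (fun S T => apDl S T X) (id1 := 0)) //.
by rewrite -apE mul0mx.
Qed.

Lemma mxexp_nil T : T ^+ 5 = 0 ->
  mxexp T = \sum_(k < 5) (k`!%:R)^-1 *: T ^+ k.
Proof.
move=> T5; apply: lim_near_cst; first exact: norm_hausdorff.
near=> n; rewrite /series /=.
have n5 : (5 <= n)%N by near: n; exists 5.
rewrite (big_cat_nat (leq0n 5) n5) //= big_mkord [X in _ + X]big_nat.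
rewrite [X in _ + X]big1 ?addr0 // => i /andP[i5 _].
by rewrite -(subnK i5) exprD T5 mulr0 scaler0.
Unshelve. all: by end_near.
Qed.

Lemma mxexp_nilE T X : T ^+ 5 = 0 ->
  mxexp T $ X = X + T $ X + 2^-1 *: (T $ (T $ X)) +
    6^-1 *: (T $ (T $ (T $ X))) + 24^-1 *: (T $ (T $ (T $ (T $ X)))).
Proof.
move=> T5; rewrite mxexp_nil // ap_suml !big_ord_recr big_ord0 /= add0r.
by rewrite !apZl !exprS expr0 mulr1 !mulJ mul1J invr1 !scale1r.
Qed.

Lemma mxexpN_nil T X : T ^+ 5 = 0 -> mxexp (- T) $ X =
  X - T $ X + 2^-1 *: (T $ (T $ X)) -
    6^-1 *: (T $ (T $ (T $ X))) + 24^-1 *: (T $ (T $ (T $ (T $ X)))).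
Proof.
move=> T5; have NT5 : (- T) ^+ 5 = 0 by rewrite exprNn T5 mulr0.
rewrite (mxexp_nilE _ NT5) !apNl !apNr !opprK.
by rewrite scalerN.
Qed.

Lemma nil_iter T X : T ^+ 5 = 0 -> T $ (T $ (T $ (T $ (T $ X)))) = 0.
Proof.
move=> T5; transitivity (T ^+ 5 $ X).
  by rewrite !exprS expr0 mulr1 !mulJ.
by rewrite T5 -apE mul0mx.
Qed.

Lemma mxexp_nilK T : T ^+ 5 = 0 -> mxexp T * mxexp (- T) = 1.
Proof.
move=> T5; apply: mx_ext => X; rewrite mulJ mul1J mxexpN_nil // mxexp_nilE //.
rewrite !(apDr, apNr, apZr) !(nil_iter _ T5) !ap0r.
move: (T $ X) (T $ (T $ X)) (T $ (T $ (T $ X))) (T $ (T $ (T $ (T $ X)))).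
move=> X1 X2 X3 X4; apply/matrixP => i j; rewrite !mxE; by field.
Qed.

(** By the Leibniz rule T^n(XY) is the binomial sum of the terms [m i j] with i + j = n. The degrees
    up to 4 of the product of the two exponentials match exp(T)(XY). The surplus degrees 5 to 8 are
    T^n(XY)/n!, which vanish because T^5 = 0; these are the relations [Z50] to [Z80]. *)
Lemma F4_mxexp_nil T : derivation T -> T ^+ 5 = 0 -> F4 R (mxexp T).
Proof.
move=> dT T5; split=> [|X Y].
  apply/unitrP; exists (mxexp (- T)); split; last exact: mxexp_nilK.
  by rewrite -{2}[T]opprK mxexp_nilK // exprNn T5 mulr0.
rewrite !jprodE !apE !mxexp_nilE //.
pose x i := iter i (ap T) X; pose y i := iter i (ap T) Y.
pose m i j := jprod (x i) (y j).
have mS i j : T $ m i j = m i.+1 j + m i j.+1 by exact: dT.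
have ml i : m 5 i = 0 by rewrite /m /x /= nil_iter // jprod0l.
have mr i : m i 5 = 0 by rewrite /m /y /= nil_iter // jprod0r.
have Z1 : T $ m 0%N 0%N = m 0%N 1%N + m 1%N 0%N by rewrite mS addrC.
have Z2 : T $ (m 0%N 1%N + m 1%N 0%N) =
    m 0%N 2%N + 2 *: m 1%N 1%N + m 2%N 0%N.
  rewrite !(apDr, apZr, mS) ?ml ?mr.
  by apply/matrixP => r s; rewrite !mxE; ring.
have Z3 : T $ (m 0%N 2%N + 2 *: m 1%N 1%N + m 2%N 0%N) =
    m 0%N 3%N + 3 *: m 1%N 2%N + 3 *: m 2%N 1%N + m 3%N 0%N.
  rewrite !(apDr, apZr, mS) ?ml ?mr.
  by apply/matrixP => r s; rewrite !mxE; ring.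
have Z4 : T $ (m 0%N 3%N + 3 *: m 1%N 2%N + 3 *: m 2%N 1%N + m 3%N 0%N) =
    m 0%N 4%N + 4 *: m 1%N 3%N + 6 *: m 2%N 2%N + 4 *: m 3%N 1%N + m 4%N 0%N.
  rewrite !(apDr, apZr, mS) ?ml ?mr.
  by apply/matrixP => r s; rewrite !mxE; ring.
have Z5 : T $ (m 0%N 4%N + 4 *: m 1%N 3%N + 6 *: m 2%N 2%N + 4 *: m 3%N 1%N +
      m 4%N 0%N) =
    5 *: m 1%N 4%N + 10 *: m 2%N 3%N + 10 *: m 3%N 2%N + 5 *: m 4%N 1%N.
  rewrite !(apDr, apZr, mS) ?ml ?mr.
  by apply/matrixP => r s; rewrite !mxE; ring.
have Z6 : T $ (5 *: m 1%N 4%N + 10 *: m 2%N 3%N + 10 *: m 3%N 2%N +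
      5 *: m 4%N 1%N) =
    15 *: m 2%N 4%N + 20 *: m 3%N 3%N + 15 *: m 4%N 2%N.
  rewrite !(apDr, apZr, mS) ?ml ?mr.
  by apply/matrixP => r s; rewrite !mxE; ring.
have Z7 : T $ (15 *: m 2%N 4%N + 20 *: m 3%N 3%N + 15 *: m 4%N 2%N) =
    35 *: m 3%N 4%N + 35 *: m 4%N 3%N.
  rewrite !(apDr, apZr, mS) ?ml ?mr.
  by apply/matrixP => r s; rewrite !mxE; ring.
have Z8 : T $ (35 *: m 3%N 4%N + 35 *: m 4%N 3%N) =
    70 *: m 4%N 4%N.
  rewrite !(apDr, apZr, mS) ?ml ?mr.
  by apply/matrixP => r s; rewrite !mxE; ring.
rewrite -[X]/(x 0%N) -[Y]/(y 0%N) -!/(x _.+1) -!/(y _.+1).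
rewrite -/(m 0%N 0%N) Z1 Z2 Z3 Z4.
have Z50 : 5 *: m 1%N 4%N + 10 *: m 2%N 3%N + 10 *: m 3%N 2%N +
    5 *: m 4%N 1%N = 0.
  by rewrite -Z5 -Z4 -Z3 -Z2 -Z1 nil_iter.
have Z60 : 15 *: m 2%N 4%N + 20 *: m 3%N 3%N + 15 *: m 4%N 2%N = 0.
  by rewrite -Z6 Z50 ap0r.
have Z70 : 35 *: m 3%N 4%N + 35 *: m 4%N 3%N = 0 by rewrite -Z7 Z60 ap0r.
have Z80 : 70 *: m 4%N 4%N = 0 by rewrite -Z8 Z70 ap0r.
rewrite !(jprodDl, jprodDr, jprodZl, jprodZr) -!/(m _ _).
apply/matrixP => r s.
move: Z50 Z60 Z70 Z80 => /matrixP/(_ r s) + /matrixP/(_ r s) + /matrixP/(_ r s)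
  + /matrixP/(_ r s).
rewrite !mxE; lra.
Qed.

End Exponentials.

(** * Exponentials of diagonalizable derivations *)

Section DiagonalExponential.
Context {R : realType}.

Notation J := 'cV[R]_27.
Notation L := 'M[R]_27.

Variables (T : L) (n : nat) (lam : 'I_n -> R) (Pi : 'I_n -> L).
Hypothesis TPi : forall i, T * Pi i = lam i *: Pi i.
Hypothesis PiT : forall i, Pi i * T = lam i *: Pi i.
Hypothesis sumPi : \sum_i Pi i = 1.

Lemma mxexp_diag t : mxexp (t *: T) = \sum_i expR (t * lam i) *: Pi i.
Proof.
have TX k : (t *: T) ^+ k = \sum_i (t * lam i) ^+ k *: Pi i.
  elim: k => [|k IH].
    by rewrite expr0 -sumPi; apply: eq_bigr => i _; rewrite expr0 scale1r.
  rewrite exprS IH mulr_sumr; apply: eq_bigr => i _.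
  rewrite -scalerAl -scalerAr TPi !scalerA exprS -mulrA.
  by rewrite [_ * lam i]mulrC mulrA.
rewrite /mxexp.
have -> : series (fun k => (k`!%:R)^-1 *: (t *: T) ^+ k) =
    fun m => \sum_i series (exp_coeff (t * lam i)) m *: Pi i.
  apply/funext => m; rewrite /series /=.
  under eq_bigr do rewrite TX scaler_sumr.
  rewrite exchange_big /=; apply: eq_bigr => i _.
  rewrite scaler_suml; apply: eq_bigr => k _.
  by rewrite scalerA mulrC.
apply: cvg_lim; first exact: norm_hausdorff.
apply: cvg_big => [|i _]; first exact: add_continuous.
by apply: cvgZr_tmp; exact: is_cvg_series_exp_coeff.
Qed.

Lemma mxexp_eigen t mu (v : J) : T $ v = mu *: v ->
  mxexp (t *: T) $ v = expR (t * mu) *: v.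
Proof.
move=> Tv; rewrite mxexp_diag ap_suml.
rewrite -[v in RHS]mul1J -sumPi ap_suml scaler_sumr; apply: eq_bigr => i _.
(* Evaluating [Pi i] on T v in two ways: v has no component for an eigenvalue other than mu. *)
have : (lam i - mu) *: (Pi i $ v) = 0.
  by rewrite scalerBl -apZl -PiT mulJ Tv apZr subrr.
rewrite apZl; move/eqP; rewrite scaler_eq0 subr_eq0.
by move=> /orP[/eqP -> //|/eqP ->]; rewrite !scaler0.
Qed.

Lemma Pi_eigen i (v : J) : T $ (Pi i $ v) = lam i *: (Pi i $ v).
Proof. by rewrite -mulJ TPi apZl. Qed.

Lemma Pi_dec (v : J) : v = \sum_i Pi i $ v.
Proof. by rewrite -ap_suml sumPi mul1J. Qed.

Lemma mxexpK t : mxexp (t *: T) * mxexp (- t *: T) = 1.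
Proof.
apply: mx_ext => X; rewrite mulJ mul1J [X]Pi_dec !ap_sum.
apply: eq_bigr => i _; rewrite !(mxexp_eigen _ (Pi_eigen _ _)) apZr.
rewrite (mxexp_eigen _ (Pi_eigen _ _)) scalerA -expRD mulNr addNr expR0.
by rewrite scale1r.
Qed.

(** A derivation adds eigenvalues: the product of eigenvectors for lam_i and lam_j satisfies the
    eigenvector equation for lam_i + lam_j. If this sum is not an eigenvalue, the product is zero
    and [mxexp_eigen] still applies. *)
Lemma F4_mxexp_diag t : derivation T -> F4 R (mxexp (t *: T)).
Proof.
move=> dT; split=> [|X Y].
  apply/unitrP; exists (mxexp (- t *: T)); split; last exact: mxexpK.
  by rewrite -{2}[t]opprK mxexpK.
rewrite !jprodE !apE [X]Pi_dec [Y]Pi_dec !(jprod_suml, ap_sum).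
apply: eq_bigr => i _; rewrite !(jprod_sumr, ap_sum); apply: eq_bigr => j _.
rewrite !(mxexp_eigen _ (Pi_eigen _ _)) jprodZl jprodZr scalerA -expRD -mulrDr.
by apply: mxexp_eigen; rewrite dT !Pi_eigen jprodZl jprodZr -scalerDl.
Qed.

End DiagonalExponential.

(** * The one-parameter group A *)

Section IwasawaA.
Context {R : realType}.

Notation O := 'cV[R]_8.
Notation J := 'cV[R]_27.
Notation L := 'M[R]_27.

Notation H := (A3 (oone : O)).

(** The polynomial t^5 - 5t^3 + 4t = t(t^2 - 1)(t^2 - 4) has the five weights as its simple
    roots. *)
Lemma A3_one_minpoly : H ^+ 5 = 5 *: H ^+ 3 - 4 *: H.
Proof.
have HE a b c (x y z : O) : H $ h1 a b c x y z =
    h1 (- (2 * oRe z)) (2 * oRe z) 0 (oconj y) (oconj x) ((b - a) *: oone).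
  by rewrite A3E omulx1 omul1x odot1l -[X in h1 _ _ _ _ _ X]scaleNr opprB.
apply: mx_ext => X; rewrite apDl apNl !apZl.
rewrite !exprS expr0 mulr1 !mulJ; jgen; rewrite !HE h1Z h1Z h1N h1D.
by apply: h1_congr; octring.
Qed.

(** The Lagrange interpolation polynomials at the nodes 2, 1, 0, -1, -2, evaluated at H; each tuple
    lists coefficients by increasing degree. *)
Definition Hproj (i : 'I_5) : L :=
  let: (c0, c1, c2, c3, c4) := nth (0, 0, 0, 0, 0)
    [:: (0, - 12^-1, - 24^-1, 12^-1, 24^-1); (0, 2 / 3, 2 / 3, - 6^-1, - 6^-1);
        (1, 0, - (5 / 4), 0, 4^-1); (0, - (2 / 3), 2 / 3, 6^-1, - 6^-1);
        (0, 12^-1, - 24^-1, - 12^-1, 24^-1)] i in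
  c0 *: 1 + c1 *: H + c2 *: H ^+ 2 + c3 *: H ^+ 3 + c4 *: H ^+ 4.

Lemma Hproj_comm i : Hproj i * H = H * Hproj i.
Proof.
rewrite /Hproj; case: (nth _ _ _) => [[[[c0 c1] c2] c3] c4].
rewrite !(mulrDl, mulrDr) -!scalerAl -!scalerAr mulr1 mul1r.
by rewrite -!exprS -!exprSr -expr2.
Qed.

Definition Hweight (i : 'I_5) : R := 2 - i%:R.

Lemma Hproj_eigen i : H * Hproj i = Hweight i *: Hproj i.
Proof.
rewrite /Hproj /Hweight.
case: i => [[|[|[|[|[|i]]]]] hi] //=.
all: rewrite !mulrDr -!scalerAr mulr1 -expr2 -!exprS A3_one_minpoly.
all: move: (H ^+ 2) (H ^+ 3) (H ^+ 4) (1 : L) H => H2 H3 H4 H0 H1.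
all: by apply/matrixP => r s; rewrite !mxE; field.
Qed.

Lemma Hproj_sum : \sum_i Hproj i = 1.
Proof.
rewrite !big_ord_recr big_ord0 /Hproj /=.
move: (H ^+ 2) (H ^+ 3) (H ^+ 4) (1 : L) H => H2 H3 H4 H0 H1.
by apply/matrixP => r s; rewrite !mxE; field.
Qed.

Lemma Hproj_eigenr i : Hproj i * H = Hweight i *: Hproj i.
Proof. by rewrite Hproj_comm Hproj_eigen. Qed.

Lemma expA_eigen t mu (v : J) : H $ v = mu *: v ->
  mxexp (t *: H) $ v = expR (t * mu) *: v.
Proof. exact: (mxexp_eigen Hproj_eigen Hproj_eigenr Hproj_sum). Qed.

Lemma expAK t : mxexp (t *: H) * mxexp (- t *: H) = 1.
Proof. exact: (mxexpK Hproj_eigen Hproj_eigenr Hproj_sum). Qed.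

Lemma F4_expA t : F4 R (mxexp (t *: H)).
Proof.
exact: (F4_mxexp_diag Hproj_eigen Hproj_eigenr Hproj_sum _ (derivation_A3 _)).
Qed.

Lemma expA_unit t : mxexp (t *: H) \is a GRing.unit.
Proof. exact: F4_unit (F4_expA t). Qed.

Lemma expAV t : (mxexp (t *: H))^-1 = mxexp (- t *: H).
Proof. by rewrite -[LHS]mulr1 -(expAK t) mulKr // expA_unit. Qed.

Lemma expA_comm t (m : L) : m * H = H * m ->
  m * mxexp (t *: H) = mxexp (t *: H) * m.
Proof.
move=> mH; rewrite (mxexp_diag Hproj_eigen Hproj_sum) mulr_sumr mulr_suml.
apply: eq_bigr => i _; rewrite -scalerAl -scalerAr; congr (_ *: _).
rewrite /Hproj; case: (nth _ _ _) => [[[[c0 c1] c2] c3] c4].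
have mX k : m * H ^+ k = H ^+ k * m.
  elim: k => [|k IH]; first by rewrite expr0 mulr1 mul1r.
  by rewrite exprS mulrA mH -mulrA IH mulrA.
by rewrite !(mulrDl, mulrDr) -!scalerAl -!scalerAr mulr1 mul1r !mX mH.
Qed.

End IwasawaA.

(** * The nilpotent Lie algebra of N^- *)

Section Unipotents.
Context {R : realType}.

Notation O := 'cV[R]_8.
Notation J := 'cV[R]_27.
Notation L := 'M[R]_27.

Implicit Types (x y p q : O) (X Y : J) (T : L).

Lemma derivationD (S T : L) :
  derivation S -> derivation T -> derivation (S + T).
Proof.
move=> dS dT X Y; rewrite !apDl dS dT !(jprodDl, jprodDr).
by rewrite addrACA.
Qed.

Lemma derivationN T : derivation T -> derivation (- T).
Proof.
move=> dT X Y; rewrite !apNl dT opprD.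
by rewrite -(scaleN1r (T $ X)) -(scaleN1r (T $ Y)) jprodZl jprodZr !scaleN1r.
Qed.

Lemma oRe_coef p : oRe p = p ord0 ord0.
Proof. by with_strategy transparent [oRe] rewrite /oRe. Qed.

Lemma ImOP p : ImO p <-> oRe p = 0.
Proof.
split=> [[c ->]|].
  rewrite oRe_coef summxE big1 // => i _.
  by rewrite !mxE /= mulr0.
move=> p0; exists (fun i => p (lift ord0 i) ord0).
apply/matrixP => k j; rewrite [j]ord1 summxE.
case: (unliftP ord0 k) => [i ->|->].
  rewrite (bigD1 i) //= big1 ?addr0 => [|l li].
    by rewrite !mxE !eqxx mulr1.
  by rewrite !mxE eqxx andbT (inj_eq lift_inj) eq_sym (negbTE li) mulr0.
rewrite big1 => [|i _]; first by rewrite -oRe_coef.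
by rewrite !mxE /= mulr0.
Qed.

Definition sP : J := h1 (-1) 1 0 0 0 (- oone).

Lemma sigmaP : sigma $ Pminus = sP.
Proof. by rewrite /Pminus /sP sigmaE; apply: h1_congr => //; octring. Qed.
Lemma sigma_sP : sigma $ sP = Pminus.
Proof. by rewrite /Pminus /sP sigmaE; apply: h1_congr => //; octring. Qed.

Lemma Gm1N x : Gm1 (- x) = - Gm1 x.
Proof.
apply: mx_ext; apply: h1_ind => a b c u v w.
rewrite Gm1E apNl Gm1E h1N.
by apply: h1_congr; octring.
Qed.
Lemma Gm2N p : Gm2 (- p) = - Gm2 p.
Proof.
apply: mx_ext; apply: h1_ind => a b c u v w.
rewrite Gm2E apNl Gm2E h1N.
by apply: h1_congr; octring.
Qed.

Definition Gm x p : L := Gm1 x + Gm2 p.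

Lemma GmN x p : Gm (- x) (- p) = - Gm x p.
Proof. by rewrite /Gm Gm1N Gm2N [RHS]opprD. Qed.

Lemma GmE (u p : O) a b c x y z : Gm u p $ h1 a b c x y z =
  h1 (2 * odot (oconj u) y - 2 * odot p z) (2 * odot u x + 2 * odot p z)
     (- (2 * odot u x) - (2 * odot (oconj u) y))
     (- ((b - c) *: u) - oconj (omul (oconj u) z) +
        (oconj (omul y p) - omul p x))
     (- oconj (omul z u) - ((c - a) *: oconj u) +
        (oconj (omul p x) - omul y p))
     (oconj (omul u y) - oconj (omul x (oconj u)) +
        (- ((a - b) *: p) + (omul p z + omul z p))).
Proof.
rewrite /Gm apDl Gm1E Gm2E h1D; apply: h1_congr => //.
exact: addr0.
Qed.

Lemma derivation_Gm x p : oRe p = 0 -> derivation (Gm x p).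
Proof.
move=> p0; apply: derivationD.
  exact: derivationD (derivation_A1 _) (derivation_A2 _).
apply: derivationD; first exact: derivation_A3.
by apply: derivationN; exact: derivation_odelta.
Qed.

Lemma Gm_sP x p : oRe p = 0 -> Gm x p $ sP = 0.
Proof.
move: p; apply: oct_ind => p0 p1 p2 p3 p4 p5 p6 p7; rewrite oct_re => ->.
by rewrite /sP GmE -h10; apply: h1_congr; octring.
Qed.

Lemma Gm_Qminus x p y : oRe p = 0 ->
  Gm x p $ Qminus y = (2 * odot x y) *: sP.
Proof.
move: p; apply: oct_ind => p0 p1 p2 p3 p4 p5 p6 p7; rewrite oct_re => ->.
by rewrite /Qminus /sP GmE h1Z; apply: h1_congr; octring.
Qed.

Lemma Gm_F31 x p q : oRe p = 0 -> oRe q = 0 ->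
  Gm x p $ F31 q = Qminus (omul q x) + (2 * odot p q) *: sP.
Proof.
move: p; apply: oct_ind => p0 p1 p2 p3 p4 p5 p6 p7; rewrite oct_re => ->.
move: q; apply: oct_ind => q0 q1 q2 q3 q4 q5 q6 q7; rewrite oct_re => ->.
rewrite /Qminus /F31 /sP GmE h1Z h1D; apply: h1_congr; octring.
Qed.

(* The weight filtration of J under A_3(1): Gm lowers the weight, and the
   weights lie in {-2, ..., 2}. *)
Lemma Gm_nil x p : oRe p = 0 -> Gm x p ^+ 5 = 0.
Proof.
move=> p0; set T := Gm x p.
(* [V1], [V2], [V3] are the sums of the weight spaces of weight at most 1, 0 and -1. The condition
   [V1] is (X | sigma P) = 0, and a vector of [V3] is [Qminus w] minus a multiple of sigma P. *)
pose V1 X := jxi2 X - jxi1 X + 2 * oRe (jx3 X) = 0.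
pose V2 X := V1 X /\ jx2 X = - oconj (jx1 X).
pose V3 X := exists a w, X = h1 a (- a) 0 w (- oconj w) (a *: oone).
have TV1 X : V1 (T $ X).
  rewrite /V1 /T; jgen; rewrite GmE !h1E.
  move: p p0 {T}; apply: oct_ind => p0 p1 p2 p3 p4 p5 p6 p7.
  rewrite oct_re => ->; octring.
have V1_h1 a b c u v w : V1 (h1 a b c u v w) -> b = a - 2 * oRe w.
  by rewrite /V1 !h1E => e; lra.
have TV2 X : V1 X -> V2 (T $ X).
  move=> X1; split; first exact: TV1.
  move: X1; rewrite /T; jgen => /V1_h1 ->; rewrite GmE !h1E.
  move: p p0 {T TV1}; apply: oct_ind => p0 p1 p2 p3 p4 p5 p6 p7.
  rewrite oct_re => ->; octring.
have TV3 X : V2 X -> V3 (T $ X).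
  rewrite /T; jgen => -[/V1_h1 ->]; rewrite !h1E => ->; rewrite GmE.
  move: p p0 {T TV1 TV2}; apply: oct_ind => p0 p1 p2 p3 p4 p5 p6 p7.
  rewrite oct_re => ->; do 2 eexists.
  by apply: h1_congr; [reflexivity| | |reflexivity| |]; octring.
have TV4 X : V3 X -> exists a, T $ X = a *: sP.
  case=> a [w ->].
  exists (2 * odot x w).
  have -> : h1 a (- a) 0 w (- oconj w) (a *: oone) = Qminus w + (- a) *: sP.
    by rewrite /Qminus /sP h1Z h1D; apply: h1_congr; octring.
  by rewrite apDr apZr Gm_sP // Gm_Qminus // scaler0 addr0.
apply: mx_ext => X; rewrite !exprS expr0 mulr1 !mulJ -[RHS]apE mul0mx.
have [a ->] := TV4 _ (TV3 _ (TV2 _ (TV1 X))).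
by rewrite apZr Gm_sP // scaler0.
Qed.

End Unipotents.

(** * Vectors of square zero and trace zero *)

Section NullVectors.
Context {R : realType}.

Notation O := 'cV[R]_8.
Notation J := 'cV[R]_27.

Implicit Types (x y z p q : O) (X Y : J).

Definition oIm z := z - oRe z *: oone.

Lemma oRe_oIm z : oRe (oIm z) = 0.
Proof. rewrite /oIm; octring. Qed.

Lemma odot_oIm z q : oRe q = 0 -> odot (oIm z) q = odot z q.
Proof.
move: q; apply: oct_ind => q0 q1 q2 q3 q4 q5 q6 q7; rewrite oct_re => ->.
rewrite /oIm; octring.
Qed.

(** Left multiplication by an imaginary octonion is skew. This removes the second-order term of the
    exponential on [F31 q] and decouples the equations for x and p in [null_nm]. *)
Lemma odot_omul_Im q x : oRe q = 0 -> odot x (omul q x) = 0.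
Proof.
move: q; apply: oct_ind => q0 q1 q2 q3 q4 q5 q6 q7; rewrite oct_re => ->.
octring.
Qed.

Lemma odot_self z : odot z z = oRe z ^+ 2 + odot (oIm z) (oIm z).
Proof. rewrite /oIm; octring. Qed.

Lemma bil_sP a b c x y z : bil (h1 a b c x y z) sP = b - a + 2 * oRe z.
Proof. by rewrite /sP bil_h1 !odot0r; octring. Qed.

Lemma bil_P a b c x y z : bil (h1 a b c x y z) Pminus = b - a - 2 * oRe z.
Proof. by rewrite /Pminus bil_h1 !odot0r; octring. Qed.

Lemma bil_Qminus a b c x y z w :
  bil (h1 a b c x y z) (Qminus w) = 2 * odot (x + oconj y) w.
Proof. by rewrite /Qminus bil_h1 !odot0r; octring. Qed.

Lemma bil_F31 a b c x y z w : bil (h1 a b c x y z) (F31 w) = - (2 * odot z w).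
Proof. by rewrite /F31 bil_h1 !odot0r; octring. Qed.

Lemma jprod_diag0 a b c x y z : jprod (h1 a b c x y z) (h1 a b c x y z) = 0 ->
  [/\ a ^+ 2 = odot y y + odot z z, b ^+ 2 + odot x x = odot z z &
      c ^+ 2 + odot x x = odot y y].
Proof.
rewrite jprod_h1 -h10 => e.
have := congr1 (@jxi1 R) e; have := congr1 (@jxi2 R) e.
have := congr1 (@jxi3 R) e; rewrite !h1E !expr2 => e3 e2 e1.
by split; lra.
Qed.

(** Eliminating |x|^2 and |y|^2 from the diagonal of Y o Y = 0, with c = -(a + b) and Re z = (a -
    b)/2, leaves (a + b)^2 = -4 |Im z|^2. Both sides vanish, and then so do x and y. *)
Lemma null_sP Y : jprod Y Y = 0 -> jtr Y = 0 -> bil Y sP = 0 ->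
  exists r, Y = r *: sP.
Proof.
move: Y; apply: h1_ind => a b c x y z /jprod_diag0[e1 e2 e3].
rewrite jtr_h1 bil_sP => tr0 c0.
rewrite (odot_self z) in e1 e2.
have zz := odot_ge0 (oIm z).
have cE : c = - (a + b) by lra.
have ab0 : (a + b) ^+ 2 = - (4 * odot (oIm z) (oIm z)).
  have zE : oRe z = (a - b) / 2 by lra.
  by rewrite cE zE in e1 e2 e3; rewrite -e3 in e1; nra.
have ab : a + b = 0.
  by apply/eqP; rewrite -sqrf_eq0 eq_le sqr_ge0 andbT ab0; lra.
have z0 : odot (oIm z) (oIm z) = 0 by rewrite ab expr0n /= in ab0; lra.
have aE : a = oRe z by lra.
have y0 : y = 0 by apply: odot_eq0; rewrite z0 -aE in e1; lra.
have x0 : x = 0.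
  by apply: odot_eq0; rewrite cE ab y0 odot0l oppr0 expr0n /= in e3; lra.
have zE : z = a *: oone.
  by apply/eqP; rewrite -subr_eq0 aE -/(oIm z) (odot_eq0 z0).
exists (- a); rewrite /sP h1Z x0 y0 zE.
apply: h1_congr; [lra|lra|lra|by rewrite scaler0|by rewrite scaler0|].
by rewrite scalerN scaleNr opprK.
Qed.

(** The normal form reached after translation by N^-. The two families of pairings say x = - conj y
    and Im z = 0; the diagonal equations then leave c = 0, x = 0 and a = -1. *)
Lemma null_P Y : jprod Y Y = 0 -> jtr Y = 0 -> bil Y sP = 4 ->
  (forall w, bil Y (Qminus w) = 0) ->
  (forall q, oRe q = 0 -> bil Y (F31 q) = 0) -> Y = Pminus.
Proof.
move: Y; apply: h1_ind => a b c x y z /jprod_diag0[e1 e2 e3].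
rewrite jtr_h1 bil_sP => tr0 c4 Q0 F0.
have xy : x = - oconj y.
  apply/eqP; rewrite -addr_eq0; apply/eqP/odot_eq0.
  by have := Q0 (x + oconj y); rewrite bil_Qminus; lra.
have z0 : odot (oIm z) (oIm z) = 0.
  by have := F0 _ (oRe_oIm z); rewrite bil_F31 -odot_oIm ?oRe_oIm //; lra.
rewrite (odot_self z) z0 addr0 in e1 e2.
have xx : odot x x = odot y y by rewrite xy odotNl odotNr opprK odot_conj.
have c0 : c = 0 by apply/eqP; rewrite -sqrf_eq0; apply/eqP; lra.
have ba : b = - a by lra.
have x0 : odot x x = 0 by rewrite ba sqrrN in e2; lra.
have zE : oRe z = 2 + a by lra.
have a1 : a = -1.
  by rewrite -xx x0 add0r zE !expr2 in e1; lra.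
have x0' : x = 0 := odot_eq0 x0.
have y0 : y = 0 by apply: odot_eq0; rewrite -xx.
have z1 : z = oone.
  apply/eqP; rewrite -subr_eq0 -(scale1r oone).
  have -> : 1 = oRe z by lra.
  by rewrite -/(oIm z) (odot_eq0 z0).
by rewrite /Pminus x0' y0 z1; apply: h1_congr => //; lra.
Qed.

Lemma null_Pminus : jprod Pminus Pminus = 0 :> J.
Proof. by rewrite /Pminus jprod_h1 -h10; apply: h1_congr; octring. Qed.

End NullVectors.

(** * Action of N^- and its coordinates *)

Section UnipotentGroup.
Context {R : realType}.

Notation O := 'cV[R]_8.
Notation J := 'cV[R]_27.
Notation L := 'M[R]_27.

Implicit Types (x y z p q w : O) (X Y : J).

Definition nm x p : L := locked (fun x p => mxexp (Gm x p)) x p.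

Lemma nmE x p : nm x p = mxexp (Gm x p).
Proof. by rewrite /nm -lock. Qed.

Lemma oReB x y : oRe (x - y) = oRe x - oRe y.
Proof. octring. Qed.

Lemma oReN p : oRe p = 0 -> oRe (- p) = 0.
Proof. by rewrite -sub0r oReB => ->; rewrite oct0 oct_re subr0. Qed.

Lemma F4_nm x p : oRe p = 0 -> F4 R (nm x p).
Proof.
move=> p0; rewrite nmE.
by apply: F4_mxexp_nil; [exact: derivation_Gm|exact: Gm_nil].
Qed.

Lemma nmV x p : oRe p = 0 -> (nm x p)^-1 = nm (- x) (- p).
Proof.
move=> p0; have u := F4_unit (F4_nm x p0).
rewrite -[LHS]mulr1 [nm (- x) _]nmE GmN -(mxexp_nilK (Gm_nil x p0)) -nmE.
exact: mulKr.
Qed.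

Lemma nm_sP x p : oRe p = 0 -> nm x p $ sP = sP.
Proof.
move=> p0; rewrite nmE (mxexp_nilE _ (Gm_nil x p0)) Gm_sP // !ap0r.
by rewrite !scaler0 !addr0.
Qed.

Lemma nm_Qminus x p w : oRe p = 0 ->
  nm x p $ Qminus w = Qminus w + (2 * odot x w) *: sP.
Proof.
move=> p0; rewrite nmE (mxexp_nilE _ (Gm_nil x p0)) Gm_Qminus // !apZr Gm_sP //.
by rewrite !(ap0r, scaler0) !addr0.
Qed.

Lemma nm_F31 x p q : oRe p = 0 -> oRe q = 0 ->
  nm x p $ F31 q = F31 q + Qminus (omul q x) + (2 * odot p q) *: sP.
Proof.
move=> p0 q0; rewrite nmE (mxexp_nilE _ (Gm_nil x p0)) Gm_F31 //.
rewrite !(apDr, apZr) Gm_Qminus // !Gm_sP //.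
rewrite (odot_omul_Im _ q0).
by rewrite mulr0 scale0r !(ap0r, scaler0, addr0) !addrA.
Qed.

Lemma QminusN w : Qminus (- w) = - Qminus w.
Proof. by rewrite /Qminus h1N; apply: h1_congr; octring. Qed.

Lemma nm_bil_sP x p X : oRe p = 0 -> bil (nm x p $ X) sP = bil X sP.
Proof.
move=> p0; rewrite (F4_bilV _ _ (F4_nm x p0)) nmV // nm_sP //; exact: oReN.
Qed.

(** By invariance of the form n can be moved, inverted, to the second argument; there the
    exponential series breaks off early, so that n X itself need not be expanded. *)
Lemma nm_bil_Qminus x p X w : oRe p = 0 ->
  bil (nm x p $ X) (Qminus w) = bil X (Qminus w) - 2 * odot x w * bil X sP.
Proof.
move=> p0; rewrite (F4_bilV _ _ (F4_nm x p0)) nmV // nm_Qminus ?oReN //.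
by rewrite bilDr bilZr odotNl mulrN mulNr.
Qed.

Lemma nm_bil_F31 x p X q : oRe p = 0 -> oRe q = 0 ->
  bil (nm x p $ X) (F31 q) =
  bil X (F31 q) - bil X (Qminus (omul q x)) - 2 * odot p q * bil X sP.
Proof.
move=> p0 q0; rewrite (F4_bilV _ _ (F4_nm x p0)) nmV // nm_F31 ?oReN //.
rewrite !bilDr bilZr odotNl mulrN mulNr; congr (_ + _ + _).
by rewrite omulNr QminusN bilNr.
Qed.

(* The coordinates of exp(Gm x p) are read off its action on any vector with a
   nonzero weight-2 component. *)
Lemma nm_inj x p x' p' X : oRe p = 0 -> oRe p' = 0 -> bil X sP != 0 ->
  nm x p $ X = nm x' p' $ X -> x = x' /\ p = p'.
Proof.
move=> p0 p0' c0 e.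
have xx : x = x'.
  apply: odot_inj => w; have := congr1 (fun Y => bil Y (Qminus w)) e.
  rewrite !nm_bil_Qminus // => /addrI/oppr_inj/(mulIf c0)/mulfI; apply.
  by rewrite pnatr_eq0.
split=> //; rewrite -{}xx in e.
have pq q : oRe q = 0 -> odot p q = odot p' q.
  move=> q0; have := congr1 (fun Y => bil Y (F31 q)) e.
  rewrite !nm_bil_F31 // => /addrI/oppr_inj/(mulIf c0)/mulfI; apply.
  by rewrite pnatr_eq0.
have pp : oRe (p - p') = 0.
  by rewrite oReB p0 p0' subrr.
apply/eqP; rewrite -subr_eq0; apply/eqP/odot_eq0.
by rewrite odotDl odotNl pq // subrr.
Qed.

Lemma null_nm X : jprod X X = 0 -> jtr X = 0 -> bil X sP != 0 ->
  exists x p, oRe p = 0 /\ X = (4^-1 * bil X sP) *: (nm x p $ Pminus).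
Proof.
move=> X2 trX c0.
(* Chosen to solve (X | Q^-(w)) = 2c (x | w) for all w, and (X | F_3(q)) = 2c (p | q) for imaginary
   q. The mixed term (X | Q^-(q x)) = 2c (x | q x) is zero, so [nm x p] makes both families of
   pairings vanish. *)
pose c := bil X sP; pose x := c^-1 *: (jx1 X + oconj (jx2 X)).
pose p := - c^-1 *: oIm (jx3 X).
have p0 : oRe p = 0.
  have := oRe_oIm (jx3 X); rewrite /p; move: (oIm _).
  apply: oct_ind => q0 q1 q2 q3 q4 q5 q6 q7; rewrite oct_re => ->; octring.
have Fn := F4_nm x p0.
exists (- x), (- p); split; first exact: oReN.
(* N^- preserves the pairing with sigma P, and that pairing is 4 at P. *)
pose Y := (4 / c) *: (nm x p $ X).
have YP : Y = Pminus.
  apply: null_P; rewrite /Y.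
  - by rewrite jprodZl jprodZr -F4_jprod // X2 ap0r !scaler0.
  - by rewrite jtrZ F4_jtr // trX mulr0.
  - by rewrite bilZl nm_bil_sP // divfK.
  - move=> w; rewrite bilZl nm_bil_Qminus //.
    rewrite [X in bil X (Qminus _)]h1_eta bil_Qminus -/c /x odotZl.
    by rewrite [X in _ * X](_ : _ = 0) ?mulr0 //; field.
  - move=> q q0; rewrite bilZl nm_bil_F31 //.
    rewrite [X in bil X (Qminus _)]h1_eta [X in bil X (F31 _)]h1_eta.
    rewrite bil_Qminus bil_F31 -/c.
    have -> : jx1 X + oconj (jx2 X) = c *: x.
      by rewrite /x scalerA mulfV // scale1r.
    rewrite odotZl (odot_omul_Im _ q0).
    rewrite /p odotZl odot_oIm //.
    by rewrite [X in _ * X](_ : _ = 0) ?mulr0 //; field.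
rewrite -nmV // -YP /Y apZr F4_mulVK // scalerA -/c.
by rewrite [X in X *: _](_ : _ = 1) ?scale1r //; field.
Qed.

End UnipotentGroup.

(** * N^+, M, and the stabilizer of the line of P *)

Section Subgroups.
Context {R : realType}.

Notation O := 'cV[R]_8.
Notation J := 'cV[R]_27.
Notation L := 'M[R]_27.
Notation H := (A3 (oone : O)).

Implicit Types (x y z p q w : O) (X Y : J) (g h k m n : L).

(** The element of N^+ with parameters (x, p), written as a sigma-conjugate; [mxexp_Gp] identifies
    it with the exponential that defines N^+. *)
Definition np x p : L := locked (fun x p => sigma * nm x p * sigma) x p.

Lemma np_sigma x p : np x p = sigma * nm x p * sigma.
Proof. by rewrite /np -lock. Qed.

Lemma sigma_sigma X : sigma $ (sigma $ X) = X.
Proof. by rewrite -mulJ sigmaK mul1J. Qed.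

Lemma npE x p X : np x p $ X = sigma $ (nm x p $ (sigma $ X)).
Proof. by rewrite np_sigma !mulJ. Qed.

Lemma sigma_Gm x p : sigma * Gm x p * sigma = Gp1 x + Gp2 p.
Proof.
apply: mx_ext; apply: h1_ind => a b c u v w; rewrite !mulJ sigmaE GmE sigmaE.
rewrite apDl [X in _ = X + _]apDl [X in _ = _ + X]apDl.
rewrite [X in _ = _ + (_ + X)]apNl.
rewrite A1E A2E A3E odeltaE h1N !h1D.
by apply: h1_congr; octring.
Qed.

Lemma mxexp_sigma (T : L) : T ^+ 5 = 0 ->
  mxexp (sigma * T * sigma) = sigma * mxexp T * sigma.
Proof.
move=> T5.
have TX X : (sigma * T * sigma) $ X = sigma $ (T $ (sigma $ X)).
  by rewrite !mulJ.
have S5 : (sigma * T * sigma) ^+ 5 = 0.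
  apply: mx_ext => X; rewrite !exprS expr0 mulr1 !mulJ !sigma_sigma.
  by rewrite nil_iter // ap0r -apE mul0mx.
apply: mx_ext => X; rewrite (mxexp_nilE _ S5) !mulJ (mxexp_nilE _ T5).
by rewrite !sigma_sigma !(apDr, apZr) sigma_sigma.
Qed.

Lemma mxexp_Gp x p : oRe p = 0 -> mxexp (Gp1 x + Gp2 p) = np x p.
Proof. by move=> p0; rewrite -sigma_Gm mxexp_sigma ?Gm_nil // np_sigma nmE. Qed.

Lemma grNmP n : grNm R n <-> exists x p, oRe p = 0 /\ n = nm x p.
Proof.
split=> [[x _ [p /ImOP p0 <-]]|[x [p [p0 ->]]]].
  by exists x, p; rewrite nmE.
by exists x => //; exists p; [exact/ImOP|rewrite nmE].
Qed.

Lemma grNpP n : grNp R n <-> exists x p, oRe p = 0 /\ n = np x p.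
Proof.
split=> [[x _ [p /ImOP p0 <-]]|[x [p [p0 ->]]]].
  by exists x, p; split=> //; exact: mxexp_Gp.
by exists x => //; exists p; [exact/ImOP|exact: mxexp_Gp].
Qed.

Lemma F4_np x p : oRe p = 0 -> F4 R (np x p).
Proof.
move=> p0; rewrite np_sigma.
exact: F4M (F4M F4_sigma (F4_nm x p0)) F4_sigma.
Qed.

Lemma npV x p : oRe p = 0 -> (np x p)^-1 = np (- x) (- p).
Proof.
move=> p0; have u := F4_unit (F4_nm x p0); have s := @sigma_unit R.
by rewrite !np_sigma !invrM ?unitrMl // sigmaV nmV // mulrA.
Qed.

Lemma np_P x p : oRe p = 0 -> np x p $ Pminus = Pminus.
Proof. by move=> p0; rewrite npE sigmaP nm_sP // sigma_sP. Qed.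

Lemma bil_sigma X : bil (sigma $ X) sP = bil X Pminus.
Proof. by rewrite -sigmaP F4_bil //; exact: F4_sigma. Qed.

Lemma np_inj x p x' p' X : oRe p = 0 -> oRe p' = 0 -> bil X Pminus != 0 ->
  np x p $ X = np x' p' $ X -> x = x' /\ p = p'.
Proof.
move=> p0 p0' c0; rewrite !npE => /(congr1 (ap sigma)); rewrite !sigma_sigma.
by apply: nm_inj => //; rewrite bil_sigma.
Qed.

Lemma bil_P_sP : bil Pminus sP = 4 :> R.
Proof. by rewrite {1}/Pminus bil_sP; octring. Qed.
Lemma bil_sP_sP : bil sP sP = 0 :> R.
Proof. by rewrite {1}/sP bil_sP; octring. Qed.

Lemma null_F4 g X : F4 R g -> jprod X X = 0 -> jtr X = 0 ->
  jprod (g $ X) (g $ X) = 0 /\ jtr (g $ X) = 0.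
Proof. by move=> Fg X2 trX; rewrite -F4_jprod // X2 ap0r F4_jtr. Qed.

Lemma jtr_P : jtr Pminus = 0 :> R.
Proof. by rewrite /Pminus jtr_h1; ring. Qed.

(** On the whole space the form is (a + b)(P | Y) + |x - conj y|^2. *)
Lemma semidefinite_P Y : bil Pminus Y = 0 -> 0 <= bil (jprod Pminus Y) Y.
Proof.
move: Y; apply: h1_ind => a b c x y z.
rewrite bilC bil_P => e.
suff -> : bil (jprod Pminus (h1 a b c x y z)) (h1 a b c x y z) =
    (a + b) * (b - a - 2 * oRe z) + odot (x - oconj y) (x - oconj y).
  by rewrite e mulr0 add0r odot_ge0.
rewrite /Pminus jprod_h1 bil_h1; clear e; octfield.
Qed.

(* P and -P are told apart by the sign of the form (P o Y | Y) on P^perp. *)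
Lemma stab_line_pos h r : F4 R h -> h $ Pminus = r *: Pminus -> 0 < r.
Proof.
move=> Fh hP.
have r0 : r != 0.
  apply/eqP => r0; move: hP; rewrite r0 scale0r => /(congr1 (ap h^-1)).
  rewrite F4_mulVK // ap0r => P0; have := bil_P_sP.
  by rewrite P0 -(scale0r Pminus) bilZl mul0r => /eqP; rewrite eq_sym pnatr_eq0.
rewrite lt_neqAle eq_sym r0 /=.
(* A vector orthogonal to P at which the form takes the value |1 + 1|^2 = 4. Its preimage Z is again
   orthogonal to P, and the form at Z equals 4r. *)
pose Y : J := Qminus oone; pose Z := h^-1 $ Y.
have YE : h $ Z = Y by rewrite F4_mulKV.
have PY : bil Pminus Y = 0.
  by rewrite /Y bilC {1}/Qminus bil_P; octring.
have PZ : bil Pminus Z = 0.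
  by rewrite -(F4_bil _ _ Fh) YE hP bilZl PY mulr0.
have := semidefinite_P PZ; rewrite -(F4_bil _ _ Fh) F4_jprod // YE hP.
rewrite jprodZl bilZl.
have -> : bil (jprod Pminus Y) Y = 4.
  by rewrite /Y /Pminus /Qminus jprod_h1 bil_h1; octfield.
by rewrite pmulr_lge0.
Qed.

Lemma H_P : H $ Pminus = 2 *: Pminus.
Proof. by rewrite /Pminus A3E h1Z; apply: h1_congr; octring. Qed.

Definition eA t : L := locked (fun t => mxexp (t *: H)) t.
Lemma eAE t : eA t = mxexp (t *: H).
Proof. by rewrite /eA -lock. Qed.

Lemma F4_eA t : F4 R (eA t).
Proof. by rewrite eAE; exact: F4_expA. Qed.
Lemma eAV t : (eA t)^-1 = eA (- t).
Proof. by rewrite !eAE expAV. Qed.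
Lemma eA_P t : eA t $ Pminus = expR (t * 2) *: Pminus.
Proof. by rewrite eAE; exact: expA_eigen H_P. Qed.

Lemma jprod_P a b c x y z : jprod Pminus (h1 a b c x y z) =
  h1 (- a - oRe z) (b - oRe z) 0 (2^-1 *: (x - oconj y))
     (2^-1 *: (oconj x - y)) ((2^-1 * (a + b)) *: oone).
Proof. by rewrite /Pminus jprod_h1; apply: h1_congr; octring. Qed.

Lemma jprod_sP a b c x y z : jprod sP (h1 a b c x y z) =
  h1 (oRe z - a) (b + oRe z) 0 (2^-1 *: (x + oconj y))
     (- (2^-1 *: (oconj x + y))) (- ((2^-1 * (a + b)) *: oone)).
Proof. by rewrite /sP jprod_h1; apply: h1_congr; octring. Qed.

Lemma H_bracket X : H $ X =
  jprod Pminus (jprod sP X) - jprod sP (jprod Pminus X).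
Proof.
by jgen; rewrite !(jprod_P, jprod_sP) A3E h1N h1D; apply: h1_congr; octfield.
Qed.

(** E_1 lies in the subalgebra generated by P and sigma P, so an automorphism fixing these two fixes
    E_1. *)
Lemma E1_P : E1 = 4^-1 *: jprod Pminus sP - 4^-1 *: (Pminus + sP) :> J.
Proof.
rewrite /E1 /Pminus /sP jprod_h1 h1D !h1Z h1N h1D; apply: h1_congr; octfield.
Qed.

Lemma jprod_E1 a b c x y z :
  jprod E1 (h1 a b c x y z) = h1 a 0 0 0 (2^-1 *: y) (2^-1 *: z).
Proof. by rewrite /E1 jprod_h1; apply: h1_congr; octring. Qed.

(** Multiplication by E_1 has eigenvalues 0, 1/2, 1, where 1 - 8t + 8t^2 takes the values 1, -1, 1.
    Being a polynomial in it, sigma commutes with every automorphism fixing E_1. *)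
Lemma sigma_E1 X : sigma $ X =
  X - 8 *: jprod E1 X + 8 *: jprod E1 (jprod E1 X).
Proof.
jgen; rewrite sigmaE !jprod_E1 !h1Z h1N !h1D; apply: h1_congr; octfield.
Qed.

Lemma eigen2_line X : H $ X = 2 *: X -> exists r, X = r *: Pminus.
Proof.
move: X; apply: h1_ind => a b c x y z; rewrite A3E h1Z => e.
have e1 := congr1 (@jxi1 R) e; have e2 := congr1 (@jxi2 R) e.
have e3 := congr1 (@jxi3 R) e; have e4 := congr1 (@jx1 R) e.
have e5 := congr1 (@jx2 R) e; have e6 := congr1 (@jx3 R) e.
rewrite !h1E ?(omulx1, omul1x) in e1 e2 e3 e4 e5 e6; clear e.
have y0 : y = 0.
  have : 4 *: y = y.
    by rewrite -[RHS]oconjK e4 oconjZ e5 scalerA; congr (_ *: _); ring.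
  move=> /eqP; rewrite -subr_eq0 -{2}(scale1r y) -scalerBl scaler_eq0.
  by rewrite subr_eq0 (eqr_nat _ 4 1) => /eqP.
have x0 : x = 0.
  have : 2 *: x = 0 by rewrite -e4 y0 oconj0.
  by move=> /eqP; rewrite scaler_eq0 pnatr_eq0 => /eqP.
exists (- a); rewrite /Pminus h1Z x0 y0; apply: h1_congr.
- lra.
- lra.
- lra.
- by rewrite scaler0.
- by rewrite scaler0.
- have -> : z = 2^-1 *: (2 *: z) by rewrite scalerA mulVf ?scale1r ?pnatr_eq0.
  by rewrite -e6 -scaleNr scalerA; congr (_ *: _); lra.
Qed.

Lemma grMP m : grM R m <->
  [/\ F4 R m, m $ Pminus = Pminus & m $ sP = sP].
Proof.
split=> [[[Fm sms] mH]|[Fm mP msP]].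
  have Km : grK R m by [].
  have mHc : m * H = H * m by rewrite -{2}mH mulrVK // F4_unit.
  have [r mP] : exists r, m $ Pminus = r *: Pminus.
    by apply: eigen2_line; rewrite -mulJ -mHc mulJ H_P apZr.
  (* m fixes E_1, hence preserves (P | E_1) = -1. *)
  have r1 : r = 1.
    have := F4_bil Pminus E1 Fm; rewrite mP (grK_E1 Km) bilZl.
    have -> : bil Pminus E1 = -1 :> R by rewrite bilC bil_E1 /Pminus h1E.
    by lra.
  rewrite r1 scale1r in mP; split=> //.
  have ms : m * sigma = sigma * m by rewrite -{2}sms !mulrA sigmaK mul1r.
  by rewrite -sigmaP -mulJ ms mulJ mP.
have mE1 : m $ E1 = E1.
  by rewrite E1_P apDr apNr !apZr apDr F4_jprod // mP msP.
have ms : m * sigma = sigma * m.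
  apply: mx_ext => X; rewrite !mulJ !sigma_E1.
  by rewrite !(apDr, apNr, apZr) !F4_jprod // mE1.
have mHc : m * H = H * m.
  apply: mx_ext => X; rewrite !mulJ !H_bracket.
  by rewrite !(apDr, apNr) !F4_jprod // mP msP.
split; last by rewrite mHc mulrK // F4_unit.
by split=> //; rewrite -mulrA ms mulrA sigmaK mul1r.
Qed.

Lemma grM_comm m t : grM R m -> m * eA t = eA t * m.
Proof.
move=> [[Fm _] mH]; rewrite eAE; apply: expA_comm.
by rewrite -{2}mH mulrVK // F4_unit.
Qed.

(** X = h^-1 sigma P is a null vector with (X | P) = 4, so [null_nm] applied to sigma X gives X = n
    sigma P with n in N^+. Then h n fixes both P and sigma P, that is, h n lies in M. *)
Lemma stab_P h : F4 R h -> h $ Pminus = Pminus ->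
  exists m x p, [/\ grM R m, oRe p = 0 & h = m * np x p].
Proof.
move=> Fh hP; have Fk := F4V Fh; pose X := h^-1 $ sP.
have kP : h^-1 $ Pminus = Pminus by rewrite -{1}hP F4_mulVK.
have sPE : sP = sigma $ Pminus :> J by rewrite sigmaP.
have [n2 n1] : jprod (sigma $ X) (sigma $ X) = 0 /\ jtr (sigma $ X) = 0.
  rewrite /X sPE -!mulJ; apply: null_F4; [|exact: null_Pminus|exact: jtr_P].
  exact: F4M (F4M F4_sigma Fk) F4_sigma.
have c4 : bil (sigma $ X) sP = 4.
  by rewrite bil_sigma -[X in bil _ X]kP /X F4_bil // bilC bil_P_sP.
have [|x [p [p0 e]]] := null_nm n2 n1; first by rewrite c4 pnatr_eq0.
rewrite c4 mulVf ?pnatr_eq0 // scale1r in e.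
have XE : X = np x p $ sP by rewrite npE sigma_sP -e sigma_sigma.
have Fn := F4_np x p0.
exists (h * np x p), (- x), (- p); split=> /=.
- apply/grMP; split; first exact: F4M.
    by rewrite mulJ np_P // hP.
  by rewrite mulJ -XE /X F4_mulKV.
- exact: oReN.
- by rewrite -npV // mulrK // F4_unit.
Qed.

(** P has weight 2, so exp(tH) scales it by e^(2t), and t = (ln r)/2 reduces to [stab_P]; the
    logarithm makes sense by [stab_line_pos]. *)
Lemma stab_line h r : F4 R h -> h $ Pminus = r *: Pminus ->
  exists m x p, [/\ grM R m, oRe p = 0 & h = m * eA (2^-1 * ln r) * np x p].
Proof.
move=> Fh hP; have r0 := stab_line_pos Fh hP; set t := 2^-1 * ln r.
have Fa : F4 R (eA t)^-1 by apply: F4V; exact: F4_eA.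
have [||m [x [p [Mm p0 e]]]] := @stab_P ((eA t)^-1 * h).
- exact: F4M.
- rewrite mulJ hP apZr eAV eA_P scalerA /t mulNr mulrAC mulVf ?pnatr_eq0 //.
  rewrite mul1r.
  by rewrite expRN lnK ?posrE // mulfV ?scale1r // gt_eqF.
exists m, x, p; split=> //; rewrite grM_comm // -mulrA -e mulrA mulrV ?mul1r //.
exact: F4_unit (F4_eA t).
Qed.

End Subgroups.

(** * The two Bruhat cells, and uniqueness of factors *)

Section Decompositions.
Context {R : realType}.

Notation O := 'cV[R]_8.
Notation J := 'cV[R]_27.
Notation L := 'M[R]_27.

Implicit Types (x y p q w : O) (X Y : J) (g h k m n : L).

Lemma grM_F4 m : grM R m -> F4 R m.
Proof. by case/grMP. Qed.

Lemma grAP a : grA R a <-> exists t, a = eA t.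
Proof.
split=> [[t _ <-]|[t ->]]; exists t; rewrite ?eAE //.
Qed.

Lemma NMANP g : NMAN R g <-> exists x p m t x' p',
  [/\ oRe p = 0, grM R m, oRe p' = 0 & g = nm x p * m * eA t * np x' p'].
Proof.
split.
  case=> _ [_ [n /grNmP[x [p [p0 ->]]] [m Mm <-]] [a /grAP[t ->] <-]].
  by case=> n' /grNpP[x' [p' [p0' ->]]] <-; exists x, p, m, t, x', p'.
case=> x [p [m [t [x' [p' [p0 Mm p0' ->]]]]]].
exists (nm x p * m * eA t); last first.
  by exists (np x' p') => //; apply/grNpP; exists x', p'.
exists (nm x p * m); last by exists (eA t) => //; apply/grAP; exists t.
by exists (nm x p); [apply/grNmP; exists x, p|exists m].
Qed.

Lemma sMANP g : sMAN R g <-> exists m t x p,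
  [/\ grM R m, oRe p = 0 & g = sigma * m * eA t * np x p].
Proof.
split.
  case=> _ [_ [_ -> [m Mm <-]] [a /grAP[t ->] <-]].
  by case=> n /grNpP[x [p [p0 ->]]] <-; exists m, t, x, p.
case=> m [t [x [p [Mm p0 ->]]]].
exists (sigma * m * eA t); last first.
  by exists (np x p) => //; apply/grNpP; exists x, p.
exists (sigma * m); last by exists (eA t) => //; apply/grAP; exists t.
by exists sigma => //; exists m.
Qed.

Lemma NsMANP g : NsMAN R g <->
  exists x p h, [/\ oRe p = 0, sMAN R h & g = nm x p * h].
Proof.
split.
  case=> _ [_ [_ [n /grNmP[x [p [p0 ->]]] [_ -> <-]] [m Mm <-]] [a Aa <-]].
  case=> n' Nn' <-; exists x, p, (sigma * m * a * n'); split; rewrite ?mulrA //.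
  exists (sigma * m * a); last by exists n'.
  by exists (sigma * m); [exists sigma => //; exists m|exists a].
case=> x [p [_ [p0 [_ [_ [_ -> [m Mm <-]] [a Aa <-]] [n' Nn' <-]] ->]]].
rewrite !mulrA; exists (nm x p * sigma * m * a); last by exists n'.
exists (nm x p * sigma * m); last by exists a.
exists (nm x p * sigma); last by exists m.
by exists (nm x p); [apply/grNmP; exists x, p|exists sigma].
Qed.

Lemma man_P m t x p : grM R m -> oRe p = 0 ->
  (m * eA t * np x p) $ Pminus = expR (t * 2) *: Pminus.
Proof.
by move=> /grMP[_ mP _] p0; rewrite !mulJ np_P // eA_P apZr mP.
Qed.

Lemma F4_man m t x p : grM R m -> oRe p = 0 -> F4 R (m * eA t * np x p).
Proof.
move=> Mm p0; exact: F4M (F4M (grM_F4 Mm) (F4_eA t)) (F4_np x p0).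
Qed.

Lemma NMAN_F4 g : NMAN R g -> F4 R g /\ 0 < bil (g $ Pminus) sP.
Proof.
move=> /NMANP[x [p [m [t [x' [p' [p0 Mm p0' ->]]]]]]].
rewrite -!mulrA [m * _]mulrA; split.
  exact: F4M (F4_nm x p0) (F4_man _ _ Mm p0').
by rewrite mulJ man_P // nm_bil_sP // bilZl bil_P_sP mulr_gt0 ?expR_gt0.
Qed.

Lemma sMAN_F4 g : sMAN R g ->
  F4 R g /\ exists2 r, 0 < r & g $ Pminus = r *: sP.
Proof.
move=> /sMANP[m [t [x [p [Mm p0 ->]]]]]; rewrite -!mulrA [m * _]mulrA; split.
  exact: F4M F4_sigma (F4_man _ _ Mm p0).
by exists (expR (t * 2)); [exact: expR_gt0|rewrite mulJ man_P // apZr sigmaP].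
Qed.

Lemma F4_NMAN g : F4 R g -> bil (g $ Pminus) sP != 0 -> NMAN R g.
Proof.
move=> Fg c0; have [g2 gt] := null_F4 Fg null_Pminus jtr_P.
have [x [p [p0 gP]]] := null_nm g2 gt c0; have Fn := F4_nm x p0.
move: gP; move: (4^-1 * _) => r gP.
have [||m [x' [p' [Mm p0' e]]]] := @stab_line R ((nm x p)^-1 * g) r.
- exact: F4M (F4V Fn) Fg.
- by rewrite mulJ gP apZr F4_mulVK.
apply/NMANP; exists x, p, m, (2^-1 * ln r), x', p'; split=> //.
by rewrite -!mulrA [m * _]mulrA -e mulVKr // F4_unit.
Qed.

Lemma F4_sMAN g : F4 R g -> bil (g $ Pminus) sP = 0 -> sMAN R g.
Proof.
move=> Fg c0; have [g2 gt] := null_F4 Fg null_Pminus jtr_P.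
have [r gP] := null_sP g2 gt c0.
have [||m [x' [p' [Mm p0' e]]]] := @stab_line R (sigma * g) r.
- exact: F4M F4_sigma Fg.
- by rewrite mulJ gP apZr sigma_sP.
apply/sMANP; exists m, (2^-1 * ln r), x', p'; split=> //.
by rewrite -!mulrA [m * _]mulrA -e mulrA sigmaK mul1r.
Qed.

(** N^- fixes sigma P, so left multiplication by it preserves the condition (gP | sigma P) = 0 that
    characterizes the small cell. For the converse, [nm 0 0] serves as the factor in N^-. *)
Lemma NsMAN_sMAN g : NsMAN R g <-> sMAN R g.
Proof.
split.
  move=> /NsMANP[x [p [h [p0 /sMAN_F4[Fh [r _ hP]] ->]]]].
  apply: F4_sMAN; first exact: F4M (F4_nm x p0) Fh.
  by rewrite mulJ hP nm_bil_sP // bilZl bil_sP_sP mulr0.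
move=> /sMAN_F4[Fg [r _ gP]]; apply/NsMANP.
have p0 : oRe (0 : O) = 0 by octring.
have Fn := F4_nm 0 p0.
exists 0, 0, ((nm 0 0)^-1 * g); split=> //; last by rewrite mulVKr // F4_unit.
apply: F4_sMAN; first exact: F4M (F4V Fn) Fg.
by rewrite mulJ gP apZr nmV // nm_sP ?oReN // bilZl bil_sP_sP mulr0.
Qed.

(** Applying the inverses to E_1 removes the factor in K. Pairing the result with P, which N^+
    fixes, gives -e^(2t); with t known, [np_inj] recovers x and p. *)
Lemma iwasawa_inj k t x p k' t' x' p' :
  grK R k -> oRe p = 0 -> grK R k' -> oRe p' = 0 ->
  k * eA t * np x p = k' * eA t' * np x' p' -> [/\ t = t', x = x' & p = p'].
Proof.
move=> Kk p0 Kk' p0' e.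
have inv l s y q : grK R l -> oRe q = 0 ->
    (l * eA s * np y q)^-1 $ E1 = np (- y) (- q) $ (eA (- s) $ E1).
  move=> Kl q0; have Fl : F4 R l by case: Kl.
  have ul := F4_unit Fl; have ua := F4_unit (F4_eA s).
  have un := F4_unit (F4_np y q0).
  rewrite invrM ?unitrMl // invrM // !mulJ npV // eAV; congr (_ $ (_ $ _)).
  by rewrite -{1}(grK_E1 Kl) F4_mulVK.
have eE := congr1 (fun g => g^-1 $ E1) e; rewrite /= !inv // in eE.
have bE s : bil (eA (- s) $ E1) Pminus = - expR (s * 2).
  rewrite (F4_bilV _ _ (F4_eA _)) eAV opprK eA_P bilZr bil_E1.
  by rewrite /Pminus h1E mulrN1.
have bN y q X : oRe q = 0 -> bil (np y q $ X) Pminus = bil X Pminus.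
  by move=> q0; rewrite (F4_bilV _ _ (F4_np y q0)) npV // np_P ?oReN.
have tt : t = t'.
  have := congr1 (fun X => bil X Pminus) eE.
  rewrite /= !bN ?oReN // !bE => /oppr_inj/expR_inj/mulIf; apply.
  by rewrite pnatr_eq0.
rewrite -tt in eE.
have [|||/oppr_inj xx /oppr_inj pp] := np_inj _ _ _ eE => //; try exact: oReN.
by rewrite bE oppr_eq0 expR_eq0.
Qed.

(** The given factorization shows that the set from which [get] chooses is inhabited, and
    [iwasawa_inj] shows that it has no other element. *)
Lemma iwasawa_nE k t x p : grK R k -> oRe p = 0 ->
  iwasawa_n (k * eA t * np x p) = np x p.
Proof.
move=> Kk p0; rewrite /iwasawa_n; set S := (X in get X).
have : S (get S).
  apply: getPex; exists (np x p); split; first by apply/grNpP; exists x, p.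
  by exists k, (eA t); split=> //; apply/grAP; exists t.
move=> [/grNpP[x' [p' [p0' ->]]] [k' [_ [Kk' /grAP[t' ->]]]]].
by move=> /(iwasawa_inj Kk p0 Kk' p0')[_ -> ->].
Qed.

(** On P the factor in M A N^+ acts by e^(2t), and N^- preserves the pairing with sigma P, so t is
    determined; [nm_inj] then gives the factor in N^-. After cancelling it, M being contained in K,
    Iwasawa uniqueness gives the rest. *)
Lemma gauss_inj x p m t x' p' y q l s y' q' :
  oRe p = 0 -> grM R m -> oRe p' = 0 ->
  oRe q = 0 -> grM R l -> oRe q' = 0 ->
  nm x p * m * eA t * np x' p' = nm y q * l * eA s * np y' q' ->
  [/\ nm x p = nm y q, m = l, eA t = eA s & np x' p' = np y' q'].
Proof.
move=> p0 Mm p0' q0 Ml q0'; rewrite -!mulrA [m * _]mulrA [l * _]mulrA => e.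
have := congr1 (fun g => g $ Pminus) e.
rewrite /= ![(nm _ _ * _) $ _]mulJ !man_P // !apZr => eP.
have st : expR (t * 2) = expR (s * 2).
  have := congr1 (fun X => bil X sP) eP.
  rewrite /= !bilZl !nm_bil_sP // bil_P_sP => /mulIf; apply.
  by rewrite pnatr_eq0.
move/expR_inj/mulIf: (st) => ts.
have {}ts : t = s by apply: ts; rewrite pnatr_eq0.
rewrite st in eP.
have {}eP : nm x p $ Pminus = nm y q $ Pminus.
  have := congr1 (fun X => (expR (s * 2))^-1 *: X) eP.
  by rewrite /= !scalerA mulVf ?scale1r // expR_eq0.
have [|xy pq] := nm_inj p0 q0 _ eP; first by rewrite bil_P_sP pnatr_eq0.
rewrite -{}xy -{}pq -{}ts in e *.
have {}e := mulrI (F4_unit (F4_nm x p0)) e.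
have [Km Kl] : grK R m /\ grK R l by case: Mm; case: Ml.
have [_ xy pq] := iwasawa_inj Km p0' Kl q0' e.
split=> //; last by rewrite xy pq.
move: e; rewrite -xy -pq => /(mulIr (F4_unit (F4_np x' p0'))).
exact: (mulIr (F4_unit (F4_eA t))).
Qed.

End Decompositions.

(** * The big cell is open and dense *)

Section Topology.
Context {R : realType}.

Notation O := 'cV[R]_8.
Notation J := 'cV[R]_27.
Notation L := 'M[R]_27.

Implicit Types (x y p q w : O) (X Y : J) (g h : L).

Lemma bil_ap_continuous X Y : continuous (fun g : L => bil (g $ X) Y).
Proof.
have -> : (fun g : L => bil (g $ X) Y) = (fun g : L =>
    \sum_i \sum_j g i j * bil (delta_mx i j $ X) Y).
  apply/funext => g; rewrite {1}[g]matrix_sum_delta.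
  pose f h := bil (h $ X) Y; rewrite -[LHS]/(f _).
  have fD h k : f (h + k) = f h + f k by rewrite /f apDl bilDl.
  have f0 : f 0 = 0.
    by rewrite /f -(scale0r (0 : L)) apZl bilZl mul0r.
  rewrite (big_morph f fD f0); apply: eq_bigr => i _.
  rewrite (big_morph f fD f0); apply: eq_bigr => j _.
  by rewrite /f apZl bilZl.
apply: continuous_big => [|i _]; first exact: add_continuous.
apply: continuous_big => [|j _ g]; first exact: add_continuous.
have h : (fun h : L => h i j) @ g --> g i j by exact: coord_continuous.
exact: (cvgMr_tmp h).
Qed.

Lemma NMAN_set g : NMAN R g <-> F4 R g /\ bil (g $ Pminus) sP != 0.
Proof.
split=> [/NMAN_F4[Fg /lt0r_neq0]//|[Fg c0]]; exact: F4_NMAN.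
Qed.

Lemma open_NMAN : open [set g : F4 R | NMAN R (set_val g)].
Proof.
exists [set g : L | bil (g $ Pminus) sP != 0].
  apply: (@open_comp _ _ (fun g : L => bil (g $ Pminus) sP)
    [set r : R | r != 0]).
    by move=> g _; exact: bil_ap_continuous.
  exact: open_neq.
apply/seteqP; split=> -[g Fg] /=.
  by move=> c0; apply/NMAN_set; split=> //; exact: set_mem Fg.
by move=> /NMAN_set[].
Qed.

Lemma GmZ t p : Gm 0 (t *: p) = t *: Gm 0 p.
Proof.
apply: mx_ext; apply: h1_ind => a b c u v w; rewrite GmE apZl GmE h1Z.
by apply: h1_congr; octring.
Qed.

(** [Gm 0 p] lowers weights by 2 and sends P to 4 F_3(p), then to 8 |p|^2 sigma P. Only this last
    term pairs nontrivially with P, with value (1/2) 8 |p|^2 4. *)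
Lemma nm0_P p : oRe p = 0 ->
  bil (nm 0 p $ Pminus) Pminus = 16 * odot p p.
Proof.
move=> p0; rewrite nmE (mxexp_nilE _ (Gm_nil 0 p0)).
have GP : Gm 0 p $ Pminus = 4 *: F31 p.
  rewrite /Pminus /F31 GmE h1Z; move: p p0; apply: oct_ind => ? ? ? ? ? ? ? ?.
  by rewrite oct_re => ->; apply: h1_congr; octring.
have GF : Gm 0 p $ F31 p = (2 * odot p p) *: sP.
  rewrite Gm_F31 // omulx0 -[RHS]add0r; congr (_ + _).
  by rewrite /Qminus oconj0 oppr0 h10.
rewrite GP !apZr GF !apZr Gm_sP // !(ap0r, scaler0) !addr0.
rewrite !bilDl !bilZl [bil sP _]bilC bil_P_sP.
have -> : bil Pminus Pminus = 0 :> R by rewrite {1}/Pminus bil_P; octring.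
have -> : bil (F31 p) Pminus = 0 by rewrite /F31 bil_P p0; ring.
by field.
Qed.

(* A group element outside the big cell moves P to the line of sigma P, and
   multiplying it by exp(t Gp2(p)) with p <> 0 brings it into the cell for every
   t <> 0. *)
Lemma dense_NMAN : dense [set g : F4 R | NMAN R (set_val g)].
Proof.
move=> U [[g0 Fg0'] Ug0] [V oV VU].
have Fg0 : F4 R g0 := set_mem Fg0'.
have [c0|c0] := eqVneq (bil (g0 $ Pminus) sP) 0; last first.
  by exists (SigSub Fg0'); split=> //=; apply/NMAN_set.
have [_ [r r0 gP]] := sMAN_F4 (F4_sMAN Fg0 c0).
pose p : O := oct 0 1 0 0 0 0 0 0.
have p0 t : oRe (t *: p) = 0 by rewrite /p octZ oct_re mulr0.
pose curve (t : R) : L := np 0 (t *: p) * g0.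
(* By nilpotency the curve is polynomial in t, which makes its continuity at 0 immediate. *)
have curveE t : curve t = \sum_(k < 5)
    ((k`!%:R)^-1 * t ^+ k) *: (sigma * Gm 0 p ^+ k * sigma * g0).
  rewrite /curve np_sigma nmE mxexp_nil ?Gm_nil // mulr_sumr !mulr_suml.
  apply: eq_bigr => k _; rewrite GmZ exprZn scalerA.
  by rewrite -scalerAr -!scalerAl.
have curve_cvg : curve t @[t --> (0 : R)^'] --> curve 0.
  apply: cvg_within_filter; rewrite curveE; under eq_fun do rewrite curveE.
  apply: cvg_big => [|k _]; first exact: add_continuous.
  apply: cvgZr_tmp; apply: cvgM; first exact: cvg_cst.
  exact: exprn_continuous.
have curve0 : curve 0 = g0.
  rewrite curveE big_ord_recl big1 => [|i _]; last first.
    by rewrite expr0n /= mulr0 scale0r.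
  by rewrite /= fact0 !expr0 !mulr1 invr1 scale1r sigmaK mul1r addr0.
have : \forall t \near (0 : R)^', V (curve t).
  apply: curve_cvg; rewrite curve0; apply: open_nbhs_nbhs; split=> //.
  by move: Ug0; rewrite -VU.
have nz : \forall t \near (0 : R)^', t != 0 by exact: nbhs_dnbhs_neq.
move=> Vc.
have Vn : \forall t \near (0 : R)^', V (curve t) /\ t != 0.
  by near=> t; split; near: t.
have [t [Vt t0]] := @filter_ex _ _ (Proper_dnbhs_numFieldType (0 : R)) _ Vn.
have Fc : F4 R (curve t) by exact: F4M (F4_np 0 (p0 t)) Fg0.
exists (SigSub (mem_set Fc)); split=> /=; first by rewrite -VU.
apply/NMAN_set; split=> //.
(* The pairing of [curve t $ Pminus] with sigma P is 16 r t^2. *)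
rewrite /curve mulJ gP apZr npE sigma_sP bilZl bil_sigma nm0_P //.
apply: mulf_neq0; first by rewrite gt_eqF.
apply: mulf_neq0; first by rewrite pnatr_eq0.
apply/eqP => /odot_eq0 /(congr1 (fun z : O => z (inord 1) ord0)).
rewrite /p octZ oct_coef //= mxE mulr1 => t00.
by rewrite t00 eqxx in t0.
Unshelve. all: by end_near.
Qed.

End Topology.

(** * Explicit Gauss coordinates, and rays *)

Section Coordinates.
Context {R : realType}.

Notation O := 'cV[R]_8.
Notation J := 'cV[R]_27.

Implicit Types (x p : O).

Lemma sum_coef_obase x : \sum_(i < 8) x i ord0 *: obase i = x.
Proof.
apply/matrixP => k j; rewrite [j]ord1 summxE (bigD1 k) //= big1 => [|i ik].
  by rewrite !mxE !eqxx mulr1 addr0.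
by rewrite !mxE eqxx andbT eq_sym (negbTE ik) mulr0.
Qed.

Lemma oRe_obase (i : 'I_8) : (0 < i)%N -> oRe (obase i : O) = 0.
Proof. by move=> i0; rewrite oRe_coef mxE eqxx andbT -val_eqE /= ltn_eqF. Qed.

(** The constant is -2 (P | sigma P) = -8, from [nm_bil_Qminus] at X = P, where (P | Q^-(w)) = 0. *)
Lemma nm_coord1 x p s : oRe p = 0 ->
  \sum_(i < 8) jform (Qminus (obase i)) (s *: (nm x p $ Pminus)) *: obase i =
  (- (8 * s)) *: x.
Proof.
move=> p0; rewrite -[x in RHS]sum_coef_obase scaler_sumr; apply: eq_bigr => i _.
rewrite bilE bilC bilZl nm_bil_Qminus // bil_P_sP odot_obase scalerA.
congr (_ *: _); rewrite /Pminus bil_Qminus oconj0 addr0 odot0l; ring.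
Qed.

(** The same constant arises from [nm_bil_F31]; omitting index 0 loses nothing on the right because
    p is imaginary. *)
Lemma nm_coord2 x p s : oRe p = 0 ->
  \sum_(i < 8 | (0 < i)%N)
     jform (F31 (obase i)) (s *: (nm x p $ Pminus)) *: obase i =
  (- (8 * s)) *: p.
Proof.
move=> p0; rewrite -[p in RHS]sum_coef_obase scaler_sumr.
rewrite [RHS](bigID (fun i : 'I_8 => (0 < i)%N)) /= [X in _ + X]big1 => [|i].
  rewrite addr0; apply: eq_bigr => i i0.
  rewrite bilE bilC bilZl nm_bil_F31 ?oRe_obase // bil_P_sP odot_obase scalerA.
  congr (_ *: _); rewrite /Pminus bil_Qminus bil_F31 oconj0 addr0 odot0l.
  by rewrite odot1l oRe_obase //; ring.
rewrite -eqn0Ngt => /eqP i0; have -> : i = ord0 by apply/val_inj.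
by rewrite -oRe_coef p0 scale0r scaler0.
Qed.

Lemma mxexp_Gm_congr x p y q : x = y -> p = q ->
  mxexp (Gm1 x + Gm2 p) = mxexp (Gm1 y + Gm2 q).
Proof. by move=> -> ->. Qed.

Lemma jcross2_sP : jcross2 sP = 0 :> J.
Proof.
by rewrite /jcross2 /sP !h1E -h10; apply: h1_congr; octring.
Qed.

Lemma N1minus_sP : N1minus (sP : J).
Proof.
split; first exact: jcross2_sP.
  by rewrite /sP jtr_h1; ring.
by rewrite bilE bil_E1 /sP h1E ltrN10.
Qed.

Lemma ray_scale (X : J) r : 0 < r -> ray (r *: X) = ray X.
Proof.
move=> r0; apply/seteqP; split=> Y [NY [s s0 YE]]; split; try exact: NY.
  by exists (s * r); [exact: mulr_gt0|rewrite YE scalerA].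
exists (s / r); first by rewrite divr_gt0.
by rewrite YE scalerA divfK ?gt_eqF.
Qed.

End Coordinates.

Theorem theorem9p10 (R : realType) :
  (* Bruhat decomposition *)
  ((F4 R = NMAN R `|` sMAN R /\ NMAN R `&` sMAN R = set0) /\
   (NMAN R = [set g | F4 R g /\
                jform (g *m Pminus) (sigma *m Pminus) != 0] /\
    NMAN R = [set g | F4 R g /\
                0 < jform (g *m Pminus) (sigma *m Pminus)]) /\
   [/\ sMAN R = NsMAN R,
       sMAN R = [set g | F4 R g /\
                   jform (g *m Pminus) (sigma *m Pminus) = 0] &
       sMAN R = [set g | F4 R g /\
                   ray (g *m Pminus) = ray (sigma *m Pminus)]] /\
   (open [set g : F4 R | NMAN R (set_val g)] /\
    dense [set g : F4 R | NMAN R (set_val g)])) /\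
  (* Gauss decomposition *)
  (forall g : 'M[R]_27, NMAN R g ->
   exists nm m a np : 'M[R]_27,
   [/\ [/\ grNm R nm, grM R m, grA R a, grNp R np & g = nm * m * a * np],
       (forall nm' m' a' np' : 'M[R]_27,
          grNm R nm' -> grM R m' -> grA R a' -> grNp R np' ->
          g = nm' * m' * a' * np' ->
          [/\ nm' = nm, m' = m, a' = a & np' = np]) &
       let gP : 'cV[R]_27 := g *m Pminus in
       let c : R := jform gP (sigma *m Pminus) in
       [/\ a = mxexp ((2^-1 * ln (4^-1 * c)) *: A3 oone),
           nm = mxexp
             (Gm1 ((- 2^-1 / c) *:
                   \sum_(i < 8) jform (Qminus (obase i)) gP *: obase i) +
              Gm2 ((- 2^-1 / c) *:
                   \sum_(i < 8 | (0 < i)%N)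
                      jform (F31 (obase i)) gP *: obase i)),
           np = iwasawa_n (nm^-1 * g) &
           m = nm^-1 * g * np^-1 * a^-1]]).
Proof.
have cE (g : 'M[R]_27) :
    jform (g *m Pminus) (sigma *m Pminus) = bil (g $ Pminus) sP.
  by rewrite bilE !apE sigmaP.
have FE g : F4 R g <-> NMAN R g \/ sMAN R g.
  split=> [Fg|[/NMAN_F4[]|/sMAN_F4[]]] //.
  by have [c0|c0] := eqVneq (bil (g $ Pminus) sP) 0;
    [right; exact: F4_sMAN|left; exact: F4_NMAN].
have s0 g : sMAN R g -> bil (g $ Pminus) sP = 0.
  by move=> /sMAN_F4[_ [r _ ->]]; rewrite bilZl bil_sP_sP mulr0.
split; [split; [|split; [|split]]|].
- split; first by apply/seteqP; split=> g /FE.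
  by apply/seteqP; split=> g // [/NMAN_F4[_ c0] /s0 c]; rewrite c ltxx in c0.
- split; apply/seteqP; split=> g /=; rewrite cE.
  + by move=> /NMAN_F4[Fg /lt0r_neq0].
  + by case; exact: F4_NMAN.
  + exact: NMAN_F4.
  + by case=> Fg /lt0r_neq0; exact: F4_NMAN.
- split; apply/seteqP; split=> g /=.
  + by move/NsMAN_sMAN.
  + by move/NsMAN_sMAN.
  + by move=> sg; rewrite cE s0 //; split=> //; apply/FE; right.
  + by rewrite cE => -[]; exact: F4_sMAN.
  + move=> /sMAN_F4[Fg [r r0 gP]]; split=> //.
    by rewrite !apE sigmaP gP ray_scale.
  + move=> [Fg]; rewrite !apE sigmaP => e; apply: F4_sMAN => //.
    (* sigma P lies in its own ray, so equality of the rays makes it a positive multiple of gP;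
       pairing with sigma P, which is isotropic, gives (gP | sigma P) = 0. *)
    have : ray (sP : 'cV[R]_27) sP.
      by split; [exact: N1minus_sP|exists 1; rewrite ?scale1r].
    rewrite -e => -[_ [r r0 sPE]].
    have := congr1 (fun X => bil X sP) sPE.
    rewrite /= bil_sP_sP bilZl => /esym/eqP.
    by rewrite mulf_eq0 gt_eqF //= => /eqP.
- by split; [exact: open_NMAN|exact: dense_NMAN].
move=> g /NMANP[x [p [m [t [x' [p' [p0 Mm p0' gE]]]]]]].
have Fn := F4_nm x p0.
have gn : (nm x p)^-1 * g = m * eA t * np x' p'.
  by rewrite gE -!mulrA mulKr ?F4_unit.
exists (nm x p), m, (eA t), (np x' p'); split.
- split=> //; [by apply/grNmP; exists x, p|by apply/grAP; exists t|].
  by apply/grNpP; exists x', p'.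
- move=> n1 m' a1 n2 /grNmP[y [q [q0 ->]]] Mm' /grAP[s ->].
  move=> /grNpP[y' [q' [q0' ->]]]; rewrite gE => /esym e.
  by have [-> -> -> ->] := gauss_inj q0 Mm' q0' p0 Mm p0' e.
have gP : g $ Pminus = expR (t * 2) *: (nm x p $ Pminus).
  by rewrite gE -!mulrA [m * _]mulrA mulJ man_P // apZr.
cbv zeta; rewrite cE.
have -> : bil (g $ Pminus) sP = expR (t * 2) * 4.
  by rewrite gP bilZl nm_bil_sP // bil_P_sP.
have e0 : expR (t * 2) != 0 by rewrite expR_eq0.
split.
- have -> : 2^-1 * ln (4^-1 * (expR (t * 2) * 4)) = t; last exact: eAE.
  by rewrite mulrCA mulVf ?pnatr_eq0 // mulr1 expRK; field.
- have gPm : g *m Pminus = expR (t * 2) *: (nm x p $ Pminus) by rewrite apE.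
  (* With s = e^(2t), the denominator (gP | sigma P) is 4s and the two sums are -8s times x and p;
     the prefactor -1/2 cancels exactly. *)
  have cc : - 2^-1 / (expR (t * 2) * 4) * - (8 * expR (t * 2)) = 1 by field.
  rewrite {1}nmE /Gm gPm.
  apply: mxexp_Gm_congr.
    by rewrite nm_coord1 // scalerA cc scale1r.
  by rewrite nm_coord2 // scalerA cc scale1r.
(* Since M is contained in K, the remaining product m a n is already an Iwasawa factorization. *)
- rewrite gn; apply: esym; apply: iwasawa_nE p0'; by case: Mm.
- rewrite gn (mulrK (F4_unit (F4_np x' p0'))).
  by rewrite (mulrK (F4_unit (F4_eA t))).
Qed.
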